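(* Let $X$ be an object in ${}^{\perp}(\mathsf{Cot}(\mathsf{Q},A)\cap\mathsf{E})$. Then each $A$-module $X(q)$ is flat for $q\in\mathsf{Q}$.
   Context: Let $\Bbbk$ be a commutative noetherian hereditary ring, $A$ an associative $\Bbbk$-algebra, and $\mathsf{Q}$ a small $\Bbbk$-linear category that is Hom-finite, locally bounded, has a Serre functor, and satisfies the strong retraction property with nilpotent pseudo-radical, where: - Hom-finite: each $\mathsf{Q}(p,q)$ is a finitely generated projective $\Bbbk$-module. - Locally bounded: for every $q\in\mathsf{Q}$ there are only finitely many objects mapping nontrivially into or out of $q$. - Serre functor: a $\Bbbk$-linear auto-equivalence $\mathbb{S}:\mathsf{Q}\to\mathsf{Q}$ with isomorphisms $\mathsf{Q}(p,q)\cong\mathrm{Hom}_{\Bbbk}(\mathsf{Q}(q,\mathbb{S}(p)),\Bbbk)$, natural in $p,q$. - Strong retraction property: for each $q$ the unit map $\Bbbk\to\mathsf{Q}(q,q)$, $x\mapsto x\cdot\mathrm{id}_q$, admits a $\Bbbk$-module retraction, and there is a (fixed) collection of $\Bbbk$-submodules $\mathfrak{r}_q$ with $\mathsf{Q}(q,q)=(\Bbbk\cdot\mathrm{id}_q)\oplus\mathfrak{r}_q$, $\mathfrak{r}_q\circ\mathfrak{r}_q\subseteq\mathfrak{r}_q$ for all $q$, and $\mathsf{Q}(q,p)\circ\mathsf{Q}(p,q)\subseteq\mathfrak{r}_q$ for all $p\neq q$. - Pseudo-radical: the ideal $\mathfrak{r}$ with $\mathfrak{r}(q,q)=\mathfrak{r}_q$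 and $\mathfrak{r}(p,q)=\mathsf{Q}(p,q)$ for $p\neq q$; nilpotent means $\mathfrak{r}^N=0$ for some $N\in\mathbb{N}$. ${}_{\mathsf{Q},A}\mathsf{Mod}$ is the category of $\Bbbk$-linear functors from $\mathsf{Q}$ to left $A$-modules; ${}_{\mathsf{Q}}\mathsf{Mod}$ is the case $A=\Bbbk$; $(-)^{\natural}:{}_{\mathsf{Q},A}\mathsf{Mod}\to{}_{\mathsf{Q}}\mathsf{Mod}$ is the forgetful functor. Exact objects: $\mathsf{E}=\{X\in{}_{\mathsf{Q},A}\mathsf{Mod}\mid\mathrm{pd}_{\mathsf{Q}}X^{\natural}<\infty\text{ or }\mathrm{id}_{\mathsf{Q}}X^{\natural}<\infty\}$, with dimensions taken in ${}_{\mathsf{Q}}\mathsf{Mod}$. $F\in{}_{\mathsf{Q},A}\mathsf{Mod}$ is flat if every epimorphism $M\to F$ is pure, i.e. $\mathrm{Hom}(T,M)\to\mathrm{Hom}(T,F)$ is surjective for every finitely presented $T$. $\mathsf{Cot}(\mathsf{Q},A)=\{N\mid\mathrm{Ext}^1_{\mathsf{Q},A}(F,N)=0\text{ for all flat }F\}$. For a class $\mathsf{D}$, ${}^{\perp}\mathsf{D}=\{M\in{}_{\mathsf{Q},A}\mathsf{Mod}\mid\mathrm{Ext}^1_{\mathsf{Q},A}(M,D)=0\ \forall D\in\mathsf{D}\}$. *)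

(* Defs.v *)
From HB Require Import structures.
From mathcomp Require Import all_boot all_algebra.

Set Implicit Arguments.
Unset Strict Implicit.
Unset Printing Implicit Defensive.

Import GRing.Theory.
Local Open Scope ring_scope.

Definition fg_module (R : pzRingType) (V : lmodType R) : Prop :=
  exists (n : nat) (v : 'I_n -> V),
    forall x : V, exists c : 'I_n -> R, x = \sum_(i < n) c i *: v i.

Definition projective_module (R : pzRingType) (P : lmodType R) : Prop :=
  forall (V W : lmodType R) (g : {linear V -> W}) (f : {linear P -> W}),
    (forall w, exists v, g v = w) ->
    exists h : {linear P -> V}, forall x, g (h x) = f x.

(* An ideal of [k] is given, up to isomorphism, as an injective linear map
   into the regular module [k^o]. *)
Definition noetherian (k : comPzRingType) : Prop :=
  forall (J : lmodType k) (i : {linear J -> k^o}), injective i -> fg_module J.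

Definition hereditary (k : comPzRingType) : Prop :=
  forall (J : lmodType k) (i : {linear J -> k^o}),
    injective i -> projective_module J.

Record is_submodule (R : pzRingType) (V : lmodType R) (P : V -> Prop) : Prop := {
  submod0 : P 0;
  submodD : forall x y, P x -> P y -> P (x + y);
  submodZ : forall c x, P x -> P (c *: x)
}.

(* [tens m x] plays the role of m (x) x in a tensor product over [A] of the
   right module [M] (a left module over the converse ring) and the left
   module [X]. *)
Section Tensor.
Variables (A : pzRingType) (M : lmodType A^c) (X : lmodType A).

Record balanced (T : zmodType) (b : M -> X -> T) : Prop := {
  balancedDl : forall m m' x, b (m + m') x = b m x + b m' x;
  balancedDr : forall m x x', b m (x + x') = b m x + b m x';
  balancedZ : forall (a : A) m x, b ((a : A^c) *: m) x = b m (a *: x)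
}.

Definition is_tensor_product (T : zmodType) (tens : M -> X -> T) : Prop :=
  balanced tens /\
  forall (Z : zmodType) (b : M -> X -> Z), balanced b ->
    (exists h : {additive T -> Z}, forall m x, h (tens m x) = b m x) /\
    (forall h h' : {additive T -> Z},
       (forall m x, h (tens m x) = b m x) ->
       (forall m x, h' (tens m x) = b m x) -> h =1 h').
End Tensor.

(* - (x)_A X preserves injections; since tensor products are determined up to
   unique isomorphism, it does not matter which ones are used. *)
Definition flat_module (A : pzRingType) (X : lmodType A) : Prop :=
  forall (M N : lmodType A^c) (f : {linear M -> N}), injective f ->
  forall (S T : zmodType) (s : M -> X -> S) (t : N -> X -> T),
    is_tensor_product s -> is_tensor_product t ->
  forall fX : {additive S -> T},
    (forall m x, fX (s m x) = t (f m) x) -> injective fX.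

(* Unlike [algType k], this does not exclude the zero algebra. *)
Record algebra (k : comPzRingType) : Type := Algebra {
  alg_ring :> pzRingType;
  alg_str : {rmorphism k -> alg_ring};
  alg_central : forall (c : k) (a : alg_ring), alg_str c * a = a * alg_str c
}.

Definition base_algebra (k : comPzRingType) : algebra k :=
  @Algebra k k (idfun : {rmorphism k -> k}) (fun c a => mulrC c a).

Section Restriction.
Variables (k : comPzRingType) (A : algebra k) (V : lmodType A).

Definition restr_scalars : Type := V.

HB.instance Definition _ := GRing.Zmodule.on restr_scalars.

Definition restr_scale (c : k) (x : restr_scalars) : restr_scalars :=
  alg_str A c *: (x : V).

Lemma restr_scaleA c d x :
  restr_scale c (restr_scale d x) = restr_scale (c * d) x.
Proof. by rewrite /restr_scale scalerA rmorphM. Qed.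

Lemma restr_scale1 : left_id 1 restr_scale.
Proof. by move=> x; rewrite /restr_scale rmorph1 scale1r. Qed.

Lemma restr_scaleDr : right_distributive restr_scale +%R.
Proof. by move=> c x y; rewrite /restr_scale scalerDr. Qed.

Lemma restr_scaleDl (x : restr_scalars) :
  {morph restr_scale^~ x : c d / c + d}.
Proof. by move=> c d; rewrite /restr_scale rmorphD scalerDl. Qed.

HB.instance Definition _ := GRing.Zmodule_isLmodule.Build k restr_scalars
  restr_scaleA restr_scale1 restr_scaleDr restr_scaleDl.
End Restriction.

Record linCat (k : comPzRingType) : Type := LinCat {
  obj :> Type;
  mor : obj -> obj -> lmodType k;
  idm : forall q, mor q q;
  cmp : forall p q r, mor q r -> mor p q -> mor p r;
  comp1m : forall p q (f : mor p q), cmp (idm q) f = f;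
  compm1 : forall p q (f : mor p q), cmp f (idm p) = f;
  compA : forall p q r s (h : mor r s) (g : mor q r) (f : mor p q),
    cmp h (cmp g f) = cmp (cmp h g) f;
  comp_linearl : forall p q r (f : mor p q) c (g g' : mor q r),
    cmp (c *: g + g') f = c *: cmp g f + cmp g' f;
  comp_linearr : forall p q r (g : mor q r) c (f f' : mor p q),
    cmp g (c *: f + f') = c *: cmp g f + cmp g f'
}.
Arguments mor {k} _ _ _.
Arguments idm {k} _ _.
Arguments cmp {k} _ {p q r} _ _.

Record linFunctor (k : comPzRingType) (C D : linCat k) : Type := LinFunctor {
  fobj :> C -> D;
  fmap : forall p q, {linear mor C p q -> mor D (fobj p) (fobj q)};
  fmap1 : forall q, fmap q q (idm C q) = idm D (fobj q);
  fmapM : forall p q r (g : mor C q r) (f : mor C p q),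
    fmap p r (cmp C g f) = cmp D (fmap q r g) (fmap p q f)
}.
Arguments fmap {k C D} _ {p q}.

Section CategoryConditions.
Variables (k : comPzRingType) (Q : linCat k).

(* The quasi-inverse [G], with natural isomorphisms from G o F and F o G to
   the identity. *)
Definition auto_equivalence (F : linFunctor Q Q) : Prop :=
  exists (G : linFunctor Q Q)
         (u : forall q, mor Q (G (F q)) q) (u' : forall q, mor Q q (G (F q)))
         (v : forall q, mor Q (F (G q)) q) (v' : forall q, mor Q q (F (G q))),
    [/\ forall q, cmp Q (u q) (u' q) = idm Q _ /\
                  cmp Q (u' q) (u q) = idm Q _,
        forall q, cmp Q (v q) (v' q) = idm Q _ /\
                  cmp Q (v' q) (v q) = idm Q _,
        forall p q (f : mor Q p q),
          cmp Q f (u p) = cmp Q (u q) (fmap G (fmap F f))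
      & forall p q (f : mor Q p q),
          cmp Q f (v p) = cmp Q (v q) (fmap F (fmap G f))].

(* [phi p q] is the isomorphism Q(p,q) ~ Hom_k(Q(q,S p), k). *)
Definition serre_functor (S : linFunctor Q Q) : Prop :=
  auto_equivalence S /\
  exists phi : forall p q, mor Q p q -> {scalar mor Q q (S p)},
    [/\ forall p q c (f f' : mor Q p q) h,
          phi p q (c *: f + f') h = c * phi p q f h + phi p q f' h,
        forall p q (f f' : mor Q p q), phi p q f =1 phi p q f' -> f = f',
        forall p q (l : {scalar mor Q q (S p)}), exists f, phi p q f =1 l,
        forall p p' q (a : mor Q p' p) (f : mor Q p q) (h : mor Q q (S p')),
          phi p' q (cmp Q f a) h = phi p q f (cmp Q (fmap S a) h)
      & forall p q q' (b : mor Q q q') (f : mor Q p q) (h : mor Q q' (S p)),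
          phi p q' (cmp Q b f) h = phi p q f (cmp Q h b)].

Definition hom_finite : Prop :=
  forall p q, fg_module (mor Q p q) /\ projective_module (mor Q p q).

Definition locally_bounded : Prop :=
  forall q, exists (n : nat) (s : 'I_n -> Q), forall p,
    (exists f : mor Q p q, f <> 0) \/ (exists f : mor Q q p, f <> 0) ->
    exists i, s i = p.

Variable r : forall q, mor Q q q -> Prop.

Record strong_retraction : Prop := {
  unit_retract : forall q, exists rho : {linear mor Q q q -> k^o},
    forall c, rho (c *: idm Q q) = c;
  r_submodule : forall q, is_submodule (@r q);
  r_sum : forall q (f : mor Q q q), exists c n, r n /\ f = c *: idm Q q + n;
  r_direct : forall q c, r (c *: idm Q q) -> c *: idm Q q = 0;
  r_mul : forall q (f g : mor Q q q), r f -> r g -> r (cmp Q g f);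
  r_through : forall p q, p <> q ->
    forall (f : mor Q q p) (g : mor Q p q), r (cmp Q g f)
}.

Inductive pseudo_radical : forall p q, mor Q p q -> Prop :=
  | pr_diag q (f : mor Q q q) : r f -> pseudo_radical f
  | pr_offdiag p q (f : mor Q p q) : p <> q -> pseudo_radical f.

(* The powers of the ideal [pseudo_radical]: power n.+1 is spanned by the
   composites of a member of power n with a member of the ideal; closure under
   scaling is automatic. *)
Inductive pseudo_radical_pow : nat -> forall p q, mor Q p q -> Prop :=
  | prp_all p q (f : mor Q p q) : pseudo_radical_pow 0 f
  | prp_comp n p x q (f : mor Q p x) (g : mor Q x q) :
      pseudo_radical_pow n f -> pseudo_radical g ->
      pseudo_radical_pow n.+1 (cmp Q g f)
  | prp_zero n p q : pseudo_radical_pow n (0 : mor Q p q)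
  | prp_add n p q (f g : mor Q p q) :
      pseudo_radical_pow n f -> pseudo_radical_pow n g ->
      pseudo_radical_pow n (f + g).

Definition nilpotent_pseudo_radical : Prop :=
  exists N, forall p q (f : mor Q p q), pseudo_radical_pow N f -> f = 0.
End CategoryConditions.

Section QMod.
Variables (k : comPzRingType) (Q : linCat k) (A : algebra k).

Record qmod : Type := QMod {
  qob :> Q -> lmodType A;
  qact : forall p q, mor Q p q -> {linear qob p -> qob q};
  qact1 : forall q x, qact (idm Q q) x = x;
  qactM : forall p q r (g : mor Q q r) (f : mor Q p q) x,
    qact (cmp Q g f) x = qact g (qact f x);
  qact_linear : forall p q c (f g : mor Q p q) x,
    qact (c *: f + g) x = alg_str A c *: qact f x + qact g x
}.

Record qhom (X Y : qmod) : Type := QHom {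
  qcomp :> forall q, {linear X q -> Y q};
  qhom_nat : forall p q (f : mor Q p q) x,
    qcomp q (qact X f x) = qact Y f (qcomp p x)
}.

Definition epi (X Y : qmod) (g : qhom X Y) : Prop :=
  forall (Z : qmod) (u v : qhom Y Z),
    (forall q x, u q (g q x) = v q (g q x)) -> forall q y, u q y = v q y.

Definition mono (X Y : qmod) (g : qhom X Y) : Prop :=
  forall (Z : qmod) (u v : qhom Z X),
    (forall q z, g q (u q z) = g q (v q z)) -> forall q z, u q z = v q z.

Definition projective (P : qmod) : Prop :=
  forall (X Y : qmod) (g : qhom X Y) (f : qhom P Y), epi g ->
    exists h : qhom P X, forall q x, g q (h q x) = f q x.

Definition injective_object (I : qmod) : Prop :=
  forall (X Y : qmod) (g : qhom X Y) (f : qhom X I), mono g ->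
    exists h : qhom Y I, forall q x, h q (g q x) = f q x.

(* Exactness is computed objectwise. *)
Definition exact_at (X Y Z : qmod) (f : qhom X Y) (g : qhom Y Z) : Prop :=
  forall q y, g q y = 0 <-> exists x, f q x = y.

Definition zero_object (X : qmod) : Prop := forall q (x : X q), x = 0.

(* There is an exact sequence
   0 -> P_n -> ... -> P_1 -> P_0 -> X -> 0 with projective P_i. *)
Definition finite_pd (X : qmod) : Prop :=
  exists (P : nat -> qmod) (d : forall i, qhom (P i.+1) (P i))
         (e : qhom (P 0) X),
    [/\ forall i, projective (P i),
        forall q x, exists y, e q y = x,
        exact_at (d 0) e,
        forall i, exact_at (d i.+1) (d i)
      & exists n : nat, forall i : nat, (n < i)%N -> zero_object (P i)].

Definition finite_id (X : qmod) : Prop :=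
  exists (I : nat -> qmod) (d : forall i, qhom (I i) (I i.+1))
         (e : qhom X (I 0)),
    [/\ forall i, injective_object (I i),
        forall q, injective (e q),
        exact_at e (d 0),
        forall i, exact_at (d i) (d i.+1)
      & exists n : nat, forall i : nat, (n < i)%N -> zero_object (I i)].

Record extension (M N : qmod) : Type := Extension {
  ext_mid : qmod;
  ext_inc : qhom N ext_mid;
  ext_prj : qhom ext_mid M;
  ext_inj : forall q, injective (ext_inc q);
  ext_exact : exact_at ext_inc ext_prj;
  ext_surj : forall q m, exists e, ext_prj q e = m
}.

Definition ext_equiv (M N : qmod) (E E' : extension M N) : Prop :=
  exists h : qhom (ext_mid E) (ext_mid E'),
    (forall q n, h q (ext_inc E q n) = ext_inc E' q n) /\
    (forall q e, ext_prj E' q (h q e) = ext_prj E q e).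

Section SplitExtension.
Variables M N : qmod.

Definition dsum_act p q (f : mor Q p q) (x : (N p * M p)%type) :
    (N q * M q)%type := (qact N f x.1, qact M f x.2).

Lemma dsum_act_linear p q (f : mor Q p q) : linear (dsum_act f).
Proof. by move=> a x y; rewrite /dsum_act /= !linearP. Qed.

HB.instance Definition _ p q (f : mor Q p q) :=
  GRing.isLinear.Build A (N p * M p)%type (N q * M q)%type *:%R
    (dsum_act f) (dsum_act_linear f).

Definition dsum : qmod.
Proof.
refine (@QMod (fun q => (N q * M q)%type : lmodType A)
              (fun p q f => dsum_act f) _ _ _).
- by move=> q [x y]; rewrite /= /dsum_act !qact1.
- by move=> p q r g f [x y]; rewrite /= /dsum_act !qactM.
- by move=> p q c f g [x y]; rewrite /= /dsum_act !qact_linear.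
Defined.

Definition dsum_inc_fun q (n : N q) : dsum q := (n, 0).
Definition dsum_prj_fun q (x : dsum q) : M q := x.2.

Lemma dsum_inc_linear q : linear (@dsum_inc_fun q).
Proof.
by move=> a x y; rewrite /dsum_inc_fun; congr pair; rewrite /= scaler0 addr0.
Qed.

Lemma dsum_prj_linear q : linear (@dsum_prj_fun q).
Proof. by []. Qed.

HB.instance Definition _ q :=
  GRing.isLinear.Build A (N q) (dsum q) *:%R (@dsum_inc_fun q)
    (@dsum_inc_linear q).
HB.instance Definition _ q :=
  GRing.isLinear.Build A (dsum q) (M q) *:%R (@dsum_prj_fun q)
    (@dsum_prj_linear q).

Definition dsum_inc : qhom N dsum.
Proof.
refine (@QHom N dsum (fun q => @dsum_inc_fun q) _).
by move=> p q f x; rewrite /= /dsum_act /dsum_inc_fun /= linear0.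
Defined.

Definition dsum_prj : qhom dsum M.
Proof. by refine (@QHom dsum M (fun q => @dsum_prj_fun q) _). Defined.

Definition split_extension : extension M N.
Proof.
refine (@Extension M N dsum dsum_inc dsum_prj _ _ _).
- by move=> q x y [].
- move=> q [x y]; split=> /= [y0 | [z [_ <-]] //].
  by exists x; rewrite /dsum_inc_fun; congr pair; rewrite -y0.
- by move=> q m; exists (0, m).
Defined.
End SplitExtension.

(* The zero element of Ext^1(M, N) is the class of the split extension. *)
Definition Ext1_vanishes (M N : qmod) : Prop :=
  forall E : extension M N, ext_equiv E (split_extension M N).

Definition left_perp (D : qmod -> Prop) (M : qmod) : Prop :=
  forall N, D N -> Ext1_vanishes M N.

Record direct_system : Type := DirectSystem {
  ds_index : Type;
  ds_le : ds_index -> ds_index -> Prop;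
  ds_refl : forall i, ds_le i i;
  ds_trans : forall i j l, ds_le i j -> ds_le j l -> ds_le i l;
  ds_nonempty : exists i : ds_index, True;
  ds_directed : forall i j, exists l, ds_le i l /\ ds_le j l;
  ds_ob :> ds_index -> qmod;
  ds_map : forall i j, ds_le i j -> qhom (ds_ob i) (ds_ob j);
  ds_map1 : forall i (le_ii : ds_le i i) q x, ds_map le_ii q x = x;
  ds_mapM : forall i j l (le_ij : ds_le i j) (le_jl : ds_le j l)
    (le_il : ds_le i l) q x, ds_map le_il q x = ds_map le_jl q (ds_map le_ij q x)
}.

Definition is_cocone (D : direct_system) (C : qmod)
    (c : forall i, qhom (D i) C) : Prop :=
  forall i j (le_ij : ds_le i j) q x, c j q (ds_map le_ij q x) = c i q x.

Definition is_direct_limit (D : direct_system) (C : qmod)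
    (c : forall i, qhom (D i) C) : Prop :=
  is_cocone c /\
  forall (Z : qmod) (z : forall i, qhom (D i) Z), is_cocone z ->
    (exists h : qhom C Z, forall i q x, h q (c i q x) = z i q x) /\
    (forall h h' : qhom C Z,
       (forall i q x, h q (c i q x) = z i q x) ->
       (forall i q x, h' q (c i q x) = z i q x) -> forall q y, h q y = h' q y).

(* Hom(T, -) preserves direct limits: the canonical map from the direct limit
   of the groups Hom(T, D i) to Hom(T, lim D) is surjective and injective. *)
Definition finitely_presented (T : qmod) : Prop :=
  forall (D : direct_system) (C : qmod) (c : forall i, qhom (D i) C),
    is_direct_limit c ->
    (forall u : qhom T C, exists i (v : qhom T (D i)),
       forall q t, u q t = c i q (v q t)) /\
    (forall i (v v' : qhom T (D i)),
       (forall q t, c i q (v q t) = c i q (v' q t)) ->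
       exists j (le_ij : ds_le i j), forall q t,
         ds_map le_ij q (v q t) = ds_map le_ij q (v' q t)).

Definition pure_epi (M F : qmod) (g : qhom M F) : Prop :=
  epi g /\
  forall T : qmod, finitely_presented T ->
    forall u : qhom T F, exists v : qhom T M, forall q t, g q (v q t) = u q t.

Definition flat_object (F : qmod) : Prop :=
  forall (M : qmod) (g : qhom M F), epi g -> pure_epi g.

Definition Cot (N : qmod) : Prop :=
  forall F : qmod, flat_object F -> Ext1_vanishes F N.
End QMod.

Section Exact.
Variables (k : comPzRingType) (Q : linCat k) (A : algebra k) (X : qmod Q A).

Definition forget_ob (q : Q) : lmodType k := restr_scalars (X q).

Definition forget_act p q (f : mor Q p q) (x : forget_ob p) : forget_ob q :=
  qact X f x.

Lemma forget_act_linear p q (f : mor Q p q) : linear (forget_act f).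
Proof. by move=> c x y; rewrite /forget_act; exact: linearP. Qed.

HB.instance Definition _ p q (f : mor Q p q) :=
  GRing.isLinear.Build k (forget_ob p) (forget_ob q) *:%R
    (forget_act f) (forget_act_linear f).

Definition forget : qmod Q (base_algebra k).
Proof.
refine (@QMod k Q (base_algebra k) forget_ob (fun p q f => forget_act f) _ _ _).
- by move=> q x; exact: (qact1 (q := q)).
- by move=> p q r g f x; exact: (qactM (q := q)).
- by move=> p q c f g x; exact: (@qact_linear k Q A X).
Defined.

Definition exact_object : Prop := finite_pd forget \/ finite_id forget.
End Exact.

(* Main.v *)
From HB Require Import structures.
From mathcomp Require Import all_boot all_algebra.
From mathcomp Require Import boolp classical_sets.
Require Import Defs.

Set Implicit Arguments.
Unset Strict Implicit.
Unset Printing Implicit Defensive.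

Import GRing.Theory Num.Theory.
Local Open Scope ring_scope.
Local Open Scope quotient_scope.
Local Open Scope classical_set_scope.

(** Let N be a right A-module, P a submodule and K = Hom(N/P, Q/Z), a left
    A-module. Evaluation X |-> X(q) is exact and has the right adjoint
    [coind q], C |-> Hom_k(Q(-,q), C), which is exact because every Q(p,q) is
    projective over k. The theorem follows from the fact that [coind q K] lies
    in Cot(Q,A) and in E, so that X is Ext-orthogonal to it.

    It lies in E ([finite_id_coind]): over the hereditary ring k, the k-module
    underlying any C has an injective resolution 0 -> C -> I0 -> I1 -> 0, and
    [coind q] turns it into a resolution by injective functors, a right adjoint
    of an exact functor preserving injectives.

    It lies in Cot ([coind_annihilator_Cot]): let 0 -> coind q K -> E -> F -> 0
    be an extension with F flat. By adjunction it splits as soon as the counit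
    (coind q K)(q) -> K extends to E(q). Lifting maps from the finitely
    presented functors given by finitely many generators at q and finitely
    many linear relations ([presented_finitely_presented]) shows that
    (coind q K)(q) -> E(q) is pure, and a map from a pure submodule to
    K = Hom(N/P, Q/Z) extends because (N/P) (x) - preserves the pure embedding
    and Q/Z is injective ([pure_extension]).

    Finally let f : M -> N be an injection of right modules. Restriction of
    characters Hom(N, Q/Z) -> Hom(M, Q/Z) is onto with a kernel K of the above
    form, for P the image of f, and so is its coinduction. As Ext(X, coind q K)
    vanishes, each map X -> coind q Hom(M, Q/Z) lifts to coind q Hom(N, Q/Z)
    ([Ext1_vanishes_lift]); by adjunction each map X(q) -> Hom(M, Q/Z), that is
    each character of M (x) X(q), extends to N (x) X(q). Since characters
    separate points, M (x) X(q) -> N (x) X(q) is injective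
    ([flat_of_character_lifting]). *)

(** * Morphisms from functions *)

Definition linear_of (R : pzRingType) (V W : lmodType R) (h : V -> W)
    (h_linear : linear h) : {linear V -> W} :=
  HB.pack_for {linear V -> W} h
    (GRing.isLinear.Build R V W *:%R h h_linear).

Lemma morphD_additive (V W : zmodType) (h : V -> W) :
  (forall x y, h (x + y) = h x + h y) -> additive h.
Proof. by move=> hD x y; apply: (addIr (h y)); rewrite -hD !subrK. Qed.

Definition additive_of (V W : zmodType) (h : V -> W)
    (hD : forall x y, h (x + y) = h x + h y) : {additive V -> W} :=
  HB.pack_for {additive V -> W} h
    (GRing.isZmodMorphism.Build V W h (morphD_additive hD)).

(** * Products, submodules and quotients of modules *)

Section Product.
Variables (R : pzRingType) (I : Type) (V : I -> lmodType R).

Definition dprod : Type := forall i, V i.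

HB.instance Definition _ := gen_eqMixin dprod.
HB.instance Definition _ := gen_choiceMixin dprod.

Implicit Types x y : dprod.
Let add x y : dprod := fun i => x i + y i.
Let opp x : dprod := fun i => - x i.
Let zero : dprod := fun i => 0.
Let scale (c : R) x : dprod := fun i => c *: x i.

Let addA : associative add.
Proof.
by move=> x y z; apply: functional_extensionality_dep => i; exact: addrA.
Qed.
Let addC : commutative add.
Proof.
by move=> x y; apply: functional_extensionality_dep => i; exact: addrC.
Qed.
Let add0 : left_id zero add.
Proof.
by move=> x; apply: functional_extensionality_dep => i; exact: add0r.
Qed.
Let addN : left_inverse zero opp add.
Proof.
by move=> x; apply: functional_extensionality_dep => i; exact: addNr.
Qed.

HB.instance Definition _ := GRing.isZmodule.Build dprod addA addC add0 addN.

Let scaleA a b x : scale a (scale b x) = scale (a * b) x.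
Proof. by apply: functional_extensionality_dep => i; exact: scalerA. Qed.
Let scale1 : left_id 1 scale.
Proof.
by move=> x; apply: functional_extensionality_dep => i; exact: scale1r.
Qed.
Let scaleDr : right_distributive scale +%R.
Proof.
by move=> a x y; apply: functional_extensionality_dep => i; exact: scalerDr.
Qed.
Let scaleDl x : {morph scale^~ x : a b / a + b}.
Proof.
by move=> a b; apply: functional_extensionality_dep => i; exact: scalerDl.
Qed.

HB.instance Definition _ :=
  GRing.Zmodule_isLmodule.Build R dprod scaleA scale1 scaleDr scaleDl.
End Product.

Section Submodule.
Variables (R : pzRingType) (V : lmodType R) (P : V -> Prop).
Variable subP : is_submodule P.

Definition submod_pred : {pred V} := fun x => `[< P x >].

Let submod_pred_closed : submod_closed submod_pred.
Proof.
split=> [|c x y]; rewrite !unfold_in /submod_pred.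
  by apply/asboolP; exact: submod0 subP.
move=> /asboolP Px /asboolP Py; apply/asboolP.
by apply: (submodD subP) => //; apply: (submodZ subP).
Qed.

HB.instance Definition _ :=
  GRing.isSubmodClosed.Build R V submod_pred submod_pred_closed.

Definition submod of is_submodule P : Type := {x : V | submod_pred x}.
Local Notation W := (submod subP).

HB.instance Definition _ := [isSub of W for @sval V submod_pred].
HB.instance Definition _ := [Choice of W by <:].
HB.instance Definition _ := [SubChoice_isSubLmodule of W by <:].

Definition submod_val (x : W) : V := val x.

Definition in_submod x (Px : P x) : W := exist _ x (asboolT Px).

Lemma submodP (x : W) : P (submod_val x).
Proof. exact: asboolW (valP x). Qed.

Lemma submod_val_inj : injective submod_val.
Proof. exact: val_inj. Qed.

Lemma submod_val_linear : linear submod_val.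
Proof. by []. Qed.

HB.instance Definition _ :=
  GRing.isLinear.Build R W V *:%R submod_val submod_val_linear.
End Submodule.

Section Range.
Variables (R : pzRingType) (V W : lmodType R) (f : {linear V -> W}).

Definition in_range (y : W) : Prop := exists x, f x = y.

Lemma in_range_submodule : is_submodule in_range.
Proof.
split=> [|_ _ [x <-] [y <-]|c _ [x <-]].
- by exists 0; rewrite linear0.
- by exists (x + y); rewrite linearD.
- by exists (c *: x); rewrite linearZ.
Qed.
End Range.

(** The laws of a module are only required up to [peq]: this covers both the
    cosets of a submodule and modules given by generators and relations, whose
    elements are classes of formal expressions. *)
Record premodule (R : pzRingType) : Type := Premodule {
  pcar :> Type;
  peq : pcar -> pcar -> Prop;
  pzero : pcar;
  padd : pcar -> pcar -> pcar;
  popp : pcar -> pcar;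
  pscale : R -> pcar -> pcar;
  peq_refl : forall x, peq x x;
  peq_sym : forall x y, peq x y -> peq y x;
  peq_trans : forall x y z, peq x y -> peq y z -> peq x z;
  peq_add : forall x x' y y', peq x x' -> peq y y' ->
    peq (padd x y) (padd x' y');
  peq_opp : forall x x', peq x x' -> peq (popp x) (popp x');
  peq_scale : forall c x x', peq x x' -> peq (pscale c x) (pscale c x');
  paddA : forall x y z, peq (padd x (padd y z)) (padd (padd x y) z);
  paddC : forall x y, peq (padd x y) (padd y x);
  padd0 : forall x, peq (padd pzero x) x;
  paddN : forall x, peq (padd (popp x) x) pzero;
  pscaleA : forall a b x, peq (pscale a (pscale b x)) (pscale (a * b) x);
  pscale1 : forall x, peq (pscale 1 x) x;
  pscaleDr : forall a x y,
    peq (pscale a (padd x y)) (padd (pscale a x) (pscale a y));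
  pscaleDl : forall a b x,
    peq (pscale (a + b) x) (padd (pscale a x) (pscale b x))
}.

Section Quotient.
Variables (R : pzRingType) (T : premodule R).

Definition pcarrier : Type := T.
HB.instance Definition _ := gen_eqMixin pcarrier.
HB.instance Definition _ := gen_choiceMixin pcarrier.

Definition peqb (x y : pcarrier) : bool := `[< peq x y >].

Let peqb_equiv : equiv_class_of peqb.
Proof.
split=> [x|x y|y x z]; first exact/asboolP/peq_refl.
  by apply/asboolP/asboolP; exact: peq_sym.
by move=> /asboolP xy /asboolP yz; apply/asboolP; exact: peq_trans yz.
Qed.

Canonical peqb_equivRel := EquivRelPack peqb_equiv.
Canonical peqb_encModRel := defaultEncModRel peqb.

Definition quotm : Type := {eq_quot peqb}.
HB.instance Definition _ := Choice.on quotm.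
HB.instance Definition _ := EqQuotient.on quotm.

Definition class (x : T) : quotm := \pi_quotm (x : pcarrier).

Lemma classP (x y : T) : class x = class y <-> peq x y.
Proof. by split=> [/eqmodP/asboolP|xy]; [|exact/eqmodP/asboolP]. Qed.

Definition rep (x : quotm) : T := repr x.

Lemma repK x : class (rep x) = x.
Proof. exact: reprK. Qed.

Lemma rep_class x : peq (rep (class x)) x.
Proof. exact/classP/repK. Qed.

Let add x y := class (padd (rep x) (rep y)).
Let opp x := class (popp (rep x)).
Let scale c x := class (pscale c (rep x)).

Let add_class x y : add (class x) (class y) = class (padd x y).
Proof. by apply/classP/peq_add; exact: rep_class. Qed.
Let opp_class x : opp (class x) = class (popp x).
Proof. by apply/classP/peq_opp; exact: rep_class. Qed.
Let scale_class c x : scale c (class x) = class (pscale c x).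
Proof. by apply/classP/peq_scale; exact: rep_class. Qed.

Let addA : associative add.
Proof.
move=> x y z; rewrite -[x]repK -[y]repK -[z]repK !add_class.
exact/classP/paddA.
Qed.
Let addC : commutative add.
Proof.
by move=> x y; rewrite -[x]repK -[y]repK !add_class; exact/classP/paddC.
Qed.
Let add0 : left_id (class (pzero T)) add.
Proof. by move=> x; rewrite -[x]repK !add_class; exact/classP/padd0. Qed.
Let addN : left_inverse (class (pzero T)) opp add.
Proof.
by move=> x; rewrite -[x]repK opp_class add_class; exact/classP/paddN.
Qed.

HB.instance Definition _ := GRing.isZmodule.Build quotm addA addC add0 addN.

Let scaleA a b x : scale a (scale b x) = scale (a * b) x.
Proof. by rewrite -[x]repK !scale_class; exact/classP/pscaleA. Qed.
Let scale1 : left_id 1 scale.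
Proof.
by move=> x; rewrite -[x]repK scale_class; exact/classP/pscale1.
Qed.
Let scaleDr : right_distributive scale +%R.
Proof.
move=> a x y; rewrite -[x]repK -[y]repK [class _ + _]add_class !scale_class.
by rewrite [RHS]add_class; exact/classP/pscaleDr.
Qed.
Let scaleDl x : {morph scale^~ x : a b / a + b}.
Proof.
move=> a b; rewrite -[x]repK !scale_class [RHS]add_class.
exact/classP/pscaleDl.
Qed.

HB.instance Definition _ :=
  GRing.Zmodule_isLmodule.Build R quotm scaleA scale1 scaleDr scaleDl.

Lemma classD x y : class (padd x y) = class x + class y.
Proof. by rewrite -add_class. Qed.
Lemma classZ c x : class (pscale c x) = c *: class x.
Proof. by rewrite -scale_class. Qed.

(** The compatibility proofs are arguments of the map, so that it carries a
    canonical linear structure. *)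
Section Lift.
Variables (W : lmodType R) (g : T -> W).
Hypotheses (g_eq : forall x y, peq x y -> g x = g y)
  (gD : forall x y, g (padd x y) = g x + g y)
  (gZ : forall c x, g (pscale c x) = c *: g x).

Definition lift_quot of (forall x y, peq x y -> g x = g y) &
    (forall x y, g (padd x y) = g x + g y) &
    (forall c x, g (pscale c x) = c *: g x) := fun x => g (rep x).
Local Notation h := (lift_quot g_eq gD gZ).

Lemma lift_class x : h (class x) = g x.
Proof. exact/g_eq/rep_class. Qed.

Lemma lift_quot_linear : linear h.
Proof.
move=> c x y; rewrite -[x]repK -[y]repK -classZ -classD !lift_class.
by rewrite gD gZ.
Qed.

HB.instance Definition _ :=
  GRing.isLinear.Build R quotm W *:%R h lift_quot_linear.
End Lift.
End Quotient.

Section Cosets.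
Variables (R : pzRingType) (V : lmodType R) (P : V -> Prop).
Hypothesis subP : is_submodule P.

Lemma submodN x : P x -> P (- x).
Proof. by move=> Px; rewrite -scaleN1r; exact: submodZ. Qed.

Lemma submodB x y : P x -> P y -> P (x - y).
Proof. by move=> Px Py; apply: (submodD subP) => //; exact: submodN. Qed.

Definition coset_premodule : premodule R.
Proof.
refine (@Premodule R V (fun x y => P (x - y)) 0 +%R -%R *:%R
          _ _ _ _ _ _ _ _ _ _ _ _ _ _).
- by move=> x; rewrite subrr; exact: submod0.
- by move=> x y Pxy; rewrite -opprB; exact: submodN.
- by move=> x y z Pxy Pyz; rewrite -(subrKA y); exact: submodD.
- by move=> x x' y y' Px Py; rewrite opprD addrACA; exact: submodD.
- by move=> x x' Px; rewrite -opprD; exact: submodN.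
- by move=> c x x' Px; rewrite -scalerBr; exact: submodZ.
- by move=> *; rewrite addrA subrr; exact: submod0.
- by move=> x y; rewrite (addrC y) subrr; exact: submod0.
- by move=> *; rewrite add0r subrr; exact: submod0.
- by move=> *; rewrite addNr subrr; exact: submod0.
- by move=> *; rewrite scalerA subrr; exact: submod0.
- by move=> *; rewrite scale1r subrr; exact: submod0.
- by move=> *; rewrite scalerDr subrr; exact: submod0.
- by move=> *; rewrite scalerDl subrr; exact: submod0.
Defined.

Definition cosets : lmodType R := quotm coset_premodule.

Definition coset (x : V) : cosets := class (x : coset_premodule).

Lemma coset_linear : linear coset.
Proof.
move=> c x y; rewrite /coset.
exact: etrans (classD (T := coset_premodule) _ _)
              (congr1 (+%R^~ _) (classZ (T := coset_premodule) _ _)).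
Qed.
HB.instance Definition _ :=
  GRing.isLinear.Build R V cosets *:%R coset coset_linear.

Lemma coset_eq0 x : coset x = 0 <-> P x.
Proof. by rewrite -(linear0 coset) classP /= subr0. Qed.

Lemma coset_surj (y : cosets) : exists x, coset x = y.
Proof. by exists (rep y); exact: repK. Qed.
End Cosets.

(** * Injective modules *)

Section Injective.
Variable R : pzRingType.

Definition single_valued (V I : lmodType R) (G : V * I -> Prop) :=
  forall z, G (0, z) -> z = 0.

(** Injectivity is phrased with partial linear maps given by their graphs, which
    spares the construction of their domains. *)
Definition inj_module (I : lmodType R) : Prop :=
  forall (V : lmodType R) (G : V * I -> Prop),
    is_submodule G -> single_valued G ->
    exists h : {linear V -> I}, forall x z, G (x, z) -> h x = z.

Definition baer (I : lmodType R) : Prop :=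
  forall G : R^o * I -> Prop, is_submodule G -> single_valued G ->
    exists y, forall c z, G (c, z) -> z = (c : R) *: y.

Lemma single_valued_eq (V I : lmodType R) (G : V * I -> Prop) x z z' :
  is_submodule G -> single_valued G -> G (x, z) -> G (x, z') -> z = z'.
Proof.
move=> subG svG Gz Gz'; apply/eqP; rewrite -subr_eq0; apply/eqP/svG.
have := submodB subG Gz Gz'.
by have -> : (x, z) - (x, z') = (x - x, z - z') by []; rewrite subrr.
Qed.

Lemma graph_linear (V I : lmodType R) (G : V * I -> Prop) :
  is_submodule G -> single_valued G -> (forall x, exists z, G (x, z)) ->
  exists h : {linear V -> I}, forall x, G (x, h x).
Proof.
move=> subG svG /choice[h Gh].
have hlin : linear h.
  move=> c x y; apply: (single_valued_eq subG svG (Gh _)).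
  exact: (submodD subG (submodZ subG c (Gh x)) (Gh y)).
by exists (linear_of hlin).
Qed.

Section Baer.
Variables (V I : lmodType R) (G : V * I -> Prop).
Hypotheses (baerI : baer I) (subG : is_submodule G) (svG : single_valued G).

(* The condition bears on the union of G and H, so that H may be empty: the
   union of an empty chain is then admissible. *)
Let partial (H : set (V * I)) :=
  is_submodule (fun p => G p \/ H p) /\ single_valued (fun p => G p \/ H p).

Let partial_chain (F : set (set (V * I))) :
  F `<=` partial -> total_on F subset -> partial (\bigcup_(X in F) X).
Proof.
move=> Fpart Ftot.
pose U p := G p \/ (\bigcup_(X in F) X) p.
rewrite /partial -/U.
have UX p : U p -> G p \/ exists2 X, F X & X p.
  by case=> [|[X FX Xp]]; [left | right; exists X].
have XU X p : F X -> G p \/ X p -> U p.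
  by move=> FX [|Xp]; [left | right; exists X].
split; last first.
  move=> z /UX [/svG // | [X /Fpart[_ svX] Xz]].
  by apply: svX; right.
split; first by left; exact: submod0 subG.
  move=> x y /UX[Gx|[X FX Xx]] /UX[Gy|[Y FY Yy]].
  - by left; exact: submodD.
  - apply: (XU Y _ FY).
    exact: (submodD (Fpart _ FY).1 (or_introl Gx) (or_intror Yy)).
  - apply: (XU X _ FX).
    exact: (submodD (Fpart _ FX).1 (or_intror Xx) (or_introl Gy)).
  - have [XY|YX] := Ftot X Y FX FY.
      apply: (XU Y _ FY).
      exact: (submodD (Fpart _ FY).1 (or_intror (XY _ Xx)) (or_intror Yy)).
    apply: (XU X _ FX).
    exact: (submodD (Fpart _ FX).1 (or_intror Xx) (or_intror (YX _ Yy))).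
move=> c x /UX[Gx|[X FX Xx]]; first by left; exact: submodZ.
apply: (XU X _ FX); exact: (submodZ (Fpart _ FX).1 c (or_intror Xx)).
Qed.

(** A maximal partial map is total: its extension to one more generator [x] is
    a matter of dividing by [x], which is what the criterion provides. *)
Lemma baer_extend :
  exists h : {linear V -> I}, forall x z, G (x, z) -> h x = z.
Proof.
have [H [[subH svH] maxH]] := Zorn_bigcup partial_chain.
pose K p := G p \/ H p; rewrite -/K in subH svH.
have tot x : exists z, K (x, z).
  pose J (p : R^o * I) := K ((p.1 : R) *: x, p.2).
  have subJ : is_submodule J.
    split=> [|p q Jp Jq|c p Jp]; rewrite /J /=.
    - by rewrite scale0r; exact: submod0 subH.
    - by rewrite scalerDl; exact: (submodD subH Jp Jq).
    - by rewrite -scalerA; exact: (submodZ subH c Jp).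
  have [|y Jy] := baerI subJ; first by move=> z; rewrite /J /= scale0r => /svH.
  pose K' (p : V * I) := exists c, K (p.1 - c *: x, p.2 - c *: y).
  have KK' p : K p -> K' p.
    by case: p => v z Kp; exists 0; rewrite !scale0r !subr0.
  have subK' : is_submodule K'.
    split=> [|p q [c Kp] [d Kq]|c p [d Kp]].
    - by apply: KK'; exact: submod0 subH.
    - exists (c + d).
      have sumE (W : lmodType R) (u v w : W) :
          (u - c *: w) + (v - d *: w) = u + v - (c + d) *: w.
        by rewrite scalerDl opprD addrACA.
      by rewrite /= -!sumE; exact: (submodD subH Kp Kq).
    - exists (c * d).
      have scaleE (W : lmodType R) (u w : W) :
          c *: (u - d *: w) = c *: u - (c * d) *: w.
        by rewrite scalerBr scalerA.
      by rewrite /= -!scaleE; exact: (submodZ subH c Kp).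
  have svK' : single_valued K'.
    move=> z [c]; rewrite /= sub0r -[X in K (X, _)]scaleNr => Jc.
    have /(congr1 (+%R^~ (c *: y))) := Jy (- c) _ Jc.
    by rewrite /= subrK scaleNr addNr.
  have partK' : partial K'.
    have GK' : (fun p => G p \/ K' p) = K'.
      apply: funext => p; apply: propext; split=> [[Gp|]//|]; last by right.
      by apply: KK'; left.
    by rewrite /partial GK'.
  have HK' : H `<=` K' by move=> p Hp; apply: KK'; right.
  have K'H : K' `<=` H.
    by apply: contrapT => nK'H; apply: (maxH K') => //; split.
  exists y; right; apply: K'H; exists 1.
  by rewrite /= !scale1r !subrr; exact: submod0 subH.
have [h Kh] := graph_linear subH svH tot.
exists h => x z Gz; apply: (single_valued_eq subH svH (Kh x)).
by left.
Qed.
End Baer.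

(** It suffices to extend maps from left ideals of [R]: by Zorn's lemma a
    partial map has a maximal extension, which must be total. *)
Theorem baer_criterion (I : lmodType R) : baer I -> inj_module I.
Proof. by move=> baerI V G subG svG; exact: baer_extend. Qed.

Lemma inj_module_extend (I V W : lmodType R) (i : {linear V -> W})
    (g : {linear V -> I}) : inj_module I -> injective i ->
  exists h : {linear W -> I}, forall x, h (i x) = g x.
Proof.
move=> injI inj_i.
have [||h hG] := injI W (fun p => exists x, p = (i x, g x)).
- split=> [|_ _ [x ->] [y ->]|c _ [x ->]].
  + by exists 0; rewrite !linear0.
  + by exists (x + y); rewrite !linearD.
  + by exists (c *: x); rewrite !linearZ.
- by move=> z [x [/esym ix ->]]; rewrite (_ : x = 0) ?linear0 //;
    apply: inj_i; rewrite linear0.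
by exists h => x; apply: hG; exists x.
Qed.

Lemma inj_module_dprod (T : Type) (I : T -> lmodType R) :
  (forall t, inj_module (I t)) -> inj_module (dprod I).
Proof.
move=> injI V G subG svG.
have exh : forall t, exists h : {linear V -> I t},
    forall x (z : dprod I), G (x, z) -> h x = z t.
  move=> t.
  pose Gt (p : V * I t) := exists2 z : dprod I, G (p.1, z) & p.2 = z t.
  have [||h hP] := injI t V Gt.
  - split=> [|p q [z Gz pz] [w Gw qw]|c p [z Gz pz]].
    + by exists 0 => //; exact: submod0 subG.
    + by exists (z + w); [exact: (submodD subG Gz Gw) | rewrite /= pz qw].
    + by exists (c *: z); [exact: (submodZ subG c Gz) | rewrite /= pz].
  - by move=> z [w /svG w0 /= ->]; rewrite w0.
  by exists h => x z Gz; apply: hP; exists z.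
pose h t := sval (cid (exh t)); have hP t := svalP (cid (exh t)).
have hlin : linear (fun x : V => (fun t => h t x) : dprod I).
  by move=> c x y; apply: functional_extensionality_dep => t; exact: linearP.
exists (linear_of hlin) => x z Gz.
by apply: functional_extensionality_dep => t; exact: hP Gz.
Qed.
End Injective.

(** * Characters with values in Q/Z *)

Lemma int_subgroup_principal (J : int -> Prop) :
  J 0 -> (forall m n, J m -> J n -> J (m + n)) -> (forall m, J m -> J (- m)) ->
  exists d : int, forall n, J n <-> exists m, n = m * d.
Proof.
move=> J0 JD JN.
have JM m n : J n -> J (m * n).
  move=> Jn; have JMn (l : nat) : J (l%:Z * n).
    elim: l => [|l IHl]; first by rewrite mul0r.
    by rewrite intS mulrDl mul1r; exact: JD.
  by case: m => l; [|rewrite NegzE mulNr; apply: JN].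
have [[n0 [n0_gt0 Jn0]] | noJ] :=
    pselect (exists n : nat, (0 < n)%N /\ J n%:Z); last first.
  exists 0 => n; split=> [Jn|[m ->]]; last by rewrite mulr0.
  exists 0; rewrite mul0r; apply: contrapT => n_neq0; apply: noJ.
  exists `|n|%N; split; first by rewrite absz_gt0; apply/eqP.
  by rewrite abszE; case: (ger0P n) => // _; exact: JN.
have exJ : exists n, (0 < n)%N && `[< J n%:Z >].
  by exists n0; rewrite n0_gt0; exact/asboolP.
case: (ex_minnP exJ) => d /andP[d_gt0 /asboolP Jd] d_min.
exists d%:Z => n; split=> [Jn|[m ->]]; last exact: JM.
exists (n %/ d)%Z.
suff mod0 : (n %% d)%Z = 0 by rewrite [LHS](divz_eq n d) mod0 addr0.
have Jmod : J (n %% d)%Z.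
  rewrite (_ : (n %% d)%Z = n + - ((n %/ d)%Z * d)).
    by apply: JD => //; apply/JN/JM.
  by rewrite [X in X - _](divz_eq n d) addrAC subrr add0r.
have d_neq0 : d%:Z != 0 by rewrite eqz_nat -lt0n.
have mod_lt : (n %% d)%Z < d%:Z by exact: ltz_pmod.
have : 0 <= (n %% d)%Z by exact: modz_ge0.
move: Jmod mod_lt; case: (n %% d)%Z => // l Jl; rewrite ltz_nat => l_lt _.
congr Posz; apply/eqP; rewrite -leqn0 leqNgt; apply/negP => l_gt0.
have := d_min l; rewrite l_gt0 leqNgt l_lt => /(_ _)/negP; apply=> //.
exact/asboolP.
Qed.

Local Notation int_module V := (zmodule V : lmodType int).

Definition is_integer (x : int_module rat) : Prop := (x : rat) \is a Num.int.

Lemma is_integer_submodule : is_submodule is_integer.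
Proof.
split=> [|x y|c x]; rewrite /is_integer ?rpred0 //; first exact: rpredD.
by rewrite scalezrE => x_int; exact: rpredMz.
Qed.

Definition QZ : lmodType int := cosets is_integer_submodule.
Definition modZ (x : rat) : QZ :=
  coset is_integer_submodule (x : int_module rat).

Lemma modZ_scale (m : int) x : m *: modZ x = modZ (m%:~R * x).
Proof. by rewrite /modZ -linearZ /= scalezrE mulrzl. Qed.

Lemma modZ_eq0 x : modZ x = 0 <-> x \is a Num.int.
Proof. exact: coset_eq0. Qed.

Lemma modZ_surj y : exists x, modZ x = y.
Proof. exact: (coset_surj (subP := is_integer_submodule) y). Qed.

(** A partial map from Z is defined on some dZ, and its value at d can be
    divided by d. *)
Lemma QZ_injective : inj_module QZ.
Proof.
apply: baer_criterion => G subG svG.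
have [|||d dP] := @int_subgroup_principal (fun m => exists z, G (m, z)).
- by exists 0; exact: submod0 subG.
- by move=> m n [z Gm] [w Gn]; exists (z + w); exact: (submodD subG Gm Gn).
- by move=> m [z Gm]; exists (- z); exact: (submodN subG Gm).
have [z Gd] : exists z, G (d, z) by apply/dP; exists 1; rewrite mul1r.
have [x xz] := modZ_surj z.
exists (modZ (x / d%:~R)) => n w Gn.
have [m def_n] : exists m, n = m * d by apply/dP; exists w.
have Gmd : G (n, m *: z) by rewrite def_n; exact: (submodZ subG m Gd).
rewrite (single_valued_eq subG svG Gn Gmd) -xz !modZ_scale def_n rmorphM /=.
have [d0|d_neq0] := eqVneq d 0; last first.
  by rewrite -mulrA (mulrCA d%:~R) divff ?mulr1 // intr_eq0.
have /modZ_eq0 x_int : modZ x = 0 by rewrite xz; apply: svG; rewrite -d0.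
rewrite d0 mulr0 mul0r -[in RHS](mulr0 m%:~R) -!modZ_scale.
by congr (_ *: _); rewrite [RHS](_ : _ = 0); apply/modZ_eq0; rewrite ?rpred0.
Qed.

(** Q/Z has elements of every order, so some nonzero value is available on the
    cyclic group of [x]; injectivity extends it to [V]. *)
Lemma character_separates (V : lmodType int) (x : V) : x <> 0 ->
  exists chi : {linear V -> QZ}, chi x <> 0.
Proof.
move=> x_neq0.
have [|||d dP] := @int_subgroup_principal (fun m => m *: x = 0).
- by rewrite scale0r.
- by move=> m n mx nx; rewrite scalerDl mx nx addr0.
- by move=> m mx; rewrite scaleNr mx oppr0.
(* Up to sign, d is the order of x, or 0 if the order is infinite, in which
   case x may be sent to any nonzero value. *)
pose t : rat := if d == 0 then 2%:~R^-1 else d%:~R^-1.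
have t_order m : m *: x = 0 -> m *: modZ t = 0.
  move=> /dP[l ->]; rewrite modZ_scale; apply/modZ_eq0.
  rewrite /t; case: eqVneq => [->|d_neq0]; first by rewrite mulr0 mul0r rpred0.
  by rewrite rmorphM /= mulfK ?rpred_int ?intr_eq0 //; exact: intr_int.
pose G (p : V * QZ) := exists m, p = (m *: x, m *: modZ t).
have [||chi chiP] := QZ_injective (V := V) (G := G).
- split=> [|_ _ [m ->] [n ->]|c _ [m ->]].
  + by exists 0; rewrite !scale0r.
  + by exists (m + n); rewrite !scalerDl.
  + by exists (c * m); rewrite -!scalerA.
- by move=> z [m [/esym mx ->]]; exact: t_order.
exists chi; rewrite (chiP x (modZ t)); last by exists 1; rewrite !scale1r.
move/modZ_eq0; rewrite /t; have [d0|d_neq0] := eqVneq d 0; first by [].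
move=> /intrP[m dm].
apply: x_neq0; rewrite -[x]scale1r; apply/dP; exists m.
apply: (@intr_inj rat); rewrite rmorphM /= -dm mulVf ?intr_eq0 //.
Qed.

Section CharacterModule.
Variables (A : pzRingType) (N : lmodType A^c).

Definition is_additive (f : dprod (fun _ : N => QZ)) : Prop :=
  forall x y, f (x + y) = f x + f y.

Lemma is_additive_submodule : is_submodule is_additive.
Proof.
split=> [x y|f g fD gD x y|c f fD x y].
- by rewrite [RHS]addr0.
- by rewrite [LHS](congr2 +%R (fD _ _) (gD _ _)) addrACA.
- by rewrite [LHS](congr1 ( *:%R c) (fD _ _)) scalerDr.
Qed.

(** Hom(N, Q/Z); the right action of [A] on [N] turns it into a left module. *)
Definition charm : Type := submod is_additive_submodule.

HB.instance Definition _ := GRing.Zmodule.on charm.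

Definition char_val (chi : charm) : N -> QZ :=
  submod_val (subP := is_additive_submodule) chi.

Lemma char_valD chi x y :
  char_val chi (x + y) = char_val chi x + char_val chi y.
Proof. exact: (submodP (subP := is_additive_submodule) chi). Qed.

Lemma charm_eq chi chi' : char_val chi =1 char_val chi' -> chi = chi'.
Proof.
move=> eq_chi; apply: (@submod_val_inj _ _ _ is_additive_submodule).
exact: functional_extensionality_dep eq_chi.
Qed.

Definition character (f : N -> QZ) (fD : forall x y, f (x + y) = f x + f y) :
  charm := in_submod is_additive_submodule (x := f) fD.

Let scale (a : A) (chi : charm) : charm.
Proof.
refine (@character (fun n => char_val chi ((a : A^c) *: n)) _).
by move=> x y; rewrite scalerDr char_valD.
Defined.

Let scaleA a b chi : scale a (scale b chi) = scale (a * b) chi.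
Proof.
apply: charm_eq => n.
exact: (congr1 (char_val chi) (scalerA (b : A^c) (a : A^c) n)).
Qed.
Let scale1 : left_id 1 scale.
Proof.
by move=> chi; apply: charm_eq => n; exact: (congr1 (char_val chi) (scale1r n)).
Qed.
Let scaleDr : right_distributive scale +%R.
Proof. by move=> a chi chi'; apply: charm_eq. Qed.
Let scaleDl chi : {morph scale^~ chi : a b / a + b}.
Proof.
move=> a b; apply: charm_eq => n.
exact: (etrans (congr1 (char_val chi) (scalerDl n (a : A^c) b))
  (char_valD chi _ _)).
Qed.

HB.instance Definition _ :=
  GRing.Zmodule_isLmodule.Build A charm scaleA scale1 scaleDr scaleDl.

Lemma char_val_add chi chi' n :
  char_val (chi + chi') n = char_val chi n + char_val chi' n.
Proof. by []. Qed.
Lemma char_val_scale (a : A) chi n :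
  char_val (a *: chi) n = char_val chi ((a : A^c) *: n).
Proof. by []. Qed.
Lemma char_val_zero n : char_val 0 n = 0.
Proof. by []. Qed.
Lemma char_val0 chi : char_val chi 0 = 0.
Proof. by apply: (addrI (char_val chi 0)); rewrite -char_valD !addr0. Qed.
Lemma char_valMz chi c n : char_val (chi *~ c) n = c *: char_val chi n.
Proof.
rewrite (_ : chi *~ c = c *: (chi : submod is_additive_submodule)) //.
by rewrite -[c in RHS]intz scaler_int.
Qed.
End CharacterModule.

Section EnoughInjectives.
Variable R : pzRingType.

Definition dual_regular : lmodType R := charm ((R^c)^o : lmodType R^c).

(** Maps into Hom(R, Q/Z) are the same as additive maps into Q/Z, by evaluation
    at 1. *)
Lemma dual_regular_injective : inj_module dual_regular.
Proof.
move=> V G subG svG.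
pose D (p : int_module V * QZ) :=
  exists2 chi : dual_regular, G (p.1, chi) & p.2 = char_val chi 1.
have [||h hP] := QZ_injective (V := int_module V) (G := D).
- split=> [|p q [x Gx px] [y Gy qy]|c p [x Gx px]].
  + by exists 0 => //; exact: submod0 subG.
  + by exists (x + y); [exact: (submodD subG Gx Gy) | rewrite /= px qy].
  + exists (x *~ c).
      have -> : ((c *: p).1, x *~ c) = (c%:~R : R) *: (p.1, x).
        by congr pair; rewrite /= scaler_int.
      exact: (submodZ subG _ Gx).
    by rewrite /= px char_valMz.
- by move=> z [chi /svG chi0 /= ->]; rewrite chi0.
have hD (v : V) (x y : R^c^o) :
    h ((x + y : R) *: v) = h ((x : R) *: v) + h ((y : R) *: v).
  by rewrite scalerDl; exact: (linearD h).
have glin : linear (fun v => character (hD v) : dual_regular).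
  move=> c v w; apply: charm_eq => x.
  rewrite [LHS](_ : _ = h ((x : R) *: (c *: v + w))) //.
  rewrite [RHS](_ : _ = h (((x : R) * c) *: v) + h ((x : R) *: w)) //.
  by rewrite scalerDr scalerA; exact: (linearD h).
exists (linear_of glin) => v chi Gv.
apply: charm_eq => x.
rewrite [LHS](_ : _ = h ((x : R) *: v)) // (hP _ (char_val ((x : R) *: chi) 1)).
  by rewrite char_val_scale; congr (char_val chi _); exact: (mulr1 (x : R^c)).
by exists ((x : R) *: chi) => //; exact: (submodZ subG _ Gv).
Qed.

(** A module embeds into the product of copies of Hom(R, Q/Z) indexed by its
    characters, as these separate points. *)
Theorem enough_injectives (V : lmodType R) :
  exists (I : lmodType R) (i : {linear V -> I}), inj_module I /\ injective i.
Proof.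
exists (dprod (fun _ : {linear int_module V -> QZ} => dual_regular)).
have hD (v : V) (chi : {linear int_module V -> QZ}) (x y : R^c^o) :
    chi ((x + y : R) *: v) = chi ((x : R) *: v) + chi ((y : R) *: v).
  by rewrite scalerDl; exact: (linearD chi).
have ilin : linear (fun v => (fun chi => character (hD v chi)) :
    dprod (fun _ : {linear int_module V -> QZ} => dual_regular)).
  move=> c v w; apply: functional_extensionality_dep => chi;
    apply: charm_eq => x.
  rewrite [LHS](_ : _ = chi ((x : R) *: (c *: v + w))) //.
  rewrite [RHS](_ : _ = chi (((x : R) * c) *: v) + chi ((x : R) *: w)) //.
  by rewrite scalerDr scalerA; exact: (linearD chi).
exists (linear_of ilin); split.
  by apply: inj_module_dprod => _; exact: dual_regular_injective.
move=> v w /= vw; apply/eqP; rewrite -subr_eq0; apply/eqP.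
apply: contrapT => vw_neq0.
have [chi] := @character_separates (int_module V) (v - w) vw_neq0; apply.
have cvw : chi ((1 : R) *: v) = chi ((1 : R) *: w).
  exact: (congr1 (fun f => char_val (f chi : dual_regular) (1 : R)) vw).
rewrite !scale1r in cvw.
by rewrite linearB /= cvw subrr.
Qed.
End EnoughInjectives.

(** The ideals of a hereditary ring are projective, so a partial map from the
    ring to [W] lifts to a partial map to [V], and extends there. *)
Lemma hereditary_quotient_injective (k : comPzRingType) (V W : lmodType k)
    (p : {linear V -> W}) :
  hereditary k -> inj_module V -> (forall w, exists v, p v = w) -> inj_module W.
Proof.
move=> hered injV p_surj; apply: baer_criterion => G subG svG.
have subJ : is_submodule (fun c : k^o => exists z, G (c, z)).
  split=> [|c d [z Gc] [w Gd]|a c [z Gc]].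
  - by exists 0; exact: submod0 subG.
  - by exists (z + w); exact: (submodD subG Gc Gd).
  - by exists (a *: z); exact: (submodZ subG a Gc).
pose val : {linear submod subJ -> k^o} := submod_val (subP := subJ).
have [g gP] : exists g : {linear submod subJ -> W}, forall x, G (val x, g x).
  have /choice[g gP] (x : submod subJ) := submodP x.
  have glin : linear g.
    move=> c x y; apply: (single_valued_eq subG svG (gP _)).
    exact: (submodD subG (submodZ subG c (gP x)) (gP y)).
  by exists (linear_of glin).
have [h hP] := hered _ val (@submod_val_inj _ _ _ subJ) V W p g p_surj.
have [y yP] := inj_module_extend h injV (@submod_val_inj _ _ _ subJ).
exists (p (y 1)) => c z Gc.
pose x := in_submod subJ (ex_intro _ z Gc).
rewrite (single_valued_eq subG svG Gc (gP x)) -hP -yP -linearZ -linearZ /=.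
by congr (p (y _)); rewrite [RHS]mulr1.
Qed.

(** * Functors given by finitely many generators and relations *)

Section Presentation.
Variables (k : comPzRingType) (Q : linCat k) (A : algebra k).
Variables (q : Q) (I J : finType) (a : I -> J -> A).

Inductive term (p : Q) : Type :=
  | Tzero
  | Tadd (s t : term p)
  | Topp (t : term p)
  | Tscale (c : A) (t : term p)
  | Tgen (f : mor Q q p) (j : J).
Arguments Tzero {p}.

Definition solution (Y : lmodType A) (y : J -> Y) : Prop :=
  forall i, \sum_j a i j *: y j = 0.

Fixpoint eval (Y : qmod Q A) (y : J -> Y q) (p : Q) (t : term p) : Y p :=
  match t with
  | Tzero => 0
  | Tadd s t => eval y s + eval y t
  | Topp t => - eval y t
  | Tscale c t => c *: eval y t
  | Tgen f j => qact Y f (y j)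
  end.

(** Two expressions are equal when they agree in every functor in which the
    relations hold; the universal property is then immediate. *)
Definition term_eq (p : Q) (s t : term p) : Prop :=
  forall (Y : qmod Q A) (y : J -> Y q), solution y -> eval y s = eval y t.

Definition term_premodule (p : Q) : premodule A.
Proof.
refine (@Premodule A (term p) (@term_eq p) Tzero (@Tadd p) (@Topp p) (@Tscale p)
          _ _ _ _ _ _ _ _ _ _ _ _ _ _).
- by move=> t Y y sol.
- by move=> s t st Y y sol; rewrite st.
- by move=> s t u st tu Y y sol; rewrite st // tu.
- by move=> s s' t t' ss tt Y y sol /=; rewrite ss // tt.
- by move=> t t' tt Y y sol /=; rewrite tt.
- by move=> c t t' tt Y y sol /=; rewrite tt.
- by move=> s t u Y y sol; exact: addrA.
- by move=> s t Y y sol; exact: addrC.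
- by move=> t Y y sol; exact: add0r.
- by move=> t Y y sol; exact: addNr.
- by move=> c d t Y y sol; exact: scalerA.
- by move=> t Y y sol; exact: scale1r.
- by move=> c s t Y y sol; exact: scalerDr.
- by move=> c d t Y y sol; exact: scalerDl.
Defined.

Definition presented_ob (p : Q) : lmodType A := quotm (term_premodule p).

Definition tclass (p : Q) (t : term p) : presented_ob p :=
  class (T := term_premodule p) t.

Lemma tclass_eq p (s t : term p) : term_eq s t -> tclass s = tclass t.
Proof. by move=> st; apply/classP. Qed.

Lemma tclass_surj p (x : presented_ob p) : exists t, tclass t = x.
Proof. by exists (rep x); exact: repK. Qed.

Lemma tclassD p (s t : term p) : tclass (Tadd s t) = tclass s + tclass t.
Proof. exact: (classD (T := term_premodule p)). Qed.

Lemma tclassZ p c (t : term p) : tclass (Tscale c t) = c *: tclass t.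
Proof. exact: (classZ (T := term_premodule p)). Qed.

Lemma tclassN p (t : term p) : tclass (Topp t) = - tclass t.
Proof.
apply/eqP; rewrite -addr_eq0 -tclassD -[0]/(tclass Tzero); apply/eqP/tclass_eq.
by move=> Y y sol; exact: addNr.
Qed.

Fixpoint term_act (p p' : Q) (g : mor Q p p') (t : term p) : term p' :=
  match t with
  | Tzero => Tzero
  | Tadd s t => Tadd (term_act g s) (term_act g t)
  | Topp t => Topp (term_act g t)
  | Tscale c t => Tscale c (term_act g t)
  | Tgen f j => Tgen (cmp Q g f) j
  end.

Lemma eval_act (Y : qmod Q A) (y : J -> Y q) p p' (g : mor Q p p') t :
  eval y (term_act g t) = qact Y g (eval y t).
Proof.
elim: t => /= [|s -> t ->|t ->|c t ->|f j].
- by rewrite linear0.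
- by rewrite linearD.
- by rewrite linearN.
- by rewrite linearZ.
- by rewrite qactM.
Qed.

Definition presented_act p p' (g : mor Q p p') :
  {linear presented_ob p -> presented_ob p'}.
Proof.
refine (@lift_quot A (term_premodule p) (presented_ob p')
          (fun t => tclass (term_act g t)) _ _ _).
- move=> s t st; apply: tclass_eq => Y y sol.
  by rewrite !eval_act (st Y y sol).
- by move=> s t; exact: tclassD.
- by move=> c t; exact: tclassZ.
Defined.

Lemma presented_actE p p' (g : mor Q p p') t :
  presented_act g (tclass t) = tclass (term_act g t).
Proof. exact: lift_class. Qed.

Definition presented : qmod Q A.
Proof.
refine (@QMod k Q A presented_ob presented_act _ _ _).
- move=> p x; have [t <-] := tclass_surj x.
  rewrite presented_actE; apply: tclass_eq => Y y sol.
  by rewrite eval_act qact1.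
- move=> p p' p'' g f x; have [t <-] := tclass_surj x.
  rewrite !presented_actE; apply: tclass_eq => Y y sol.
  by rewrite !eval_act qactM.
- move=> p p' c f g x; have [t <-] := tclass_surj x.
  rewrite !presented_actE -tclassZ -tclassD; apply: tclass_eq => Y y sol.
  by rewrite /= !eval_act qact_linear.
Defined.

Definition gen (j : J) : presented q := tclass (Tgen (idm Q q) j).

Lemma presented_hom (Y : qmod Q A) (y : J -> Y q) : solution y ->
  exists u : qhom presented Y, forall j, u q (gen j) = y j.
Proof.
move=> sol.
pose u p : {linear presented_ob p -> Y p} :=
  @lift_quot A (term_premodule p) (Y p) (@eval Y y p)
    (fun s t st => st Y y sol) (fun s t => erefl) (fun c t => erefl).
have uE p (t : term p) : u p (tclass t) = eval y t by exact: lift_class.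
have u_nat p p' (g : mor Q p p') x :
    u p' (qact presented g x) = qact Y g (u p x).
  have [t <-] := tclass_surj x.
  by rewrite [qact _ _ _]presented_actE !uE eval_act.
by exists (QHom u_nat) => j; rewrite [LHS]uE /= qact1.
Qed.

Lemma presented_hom_eval (Y : qmod Q A) (u : qhom presented Y) p (t : term p) :
  u p (tclass t) = eval (fun j => u q (gen j)) t.
Proof.
elim: t => [|s IHs t IHt|t IHt|c t IHt|f j] /=.
- exact: linear0.
- by rewrite tclassD linearD IHs IHt.
- by rewrite tclassN linearN IHt.
- by rewrite tclassZ linearZ /= IHt.
- rewrite -qhom_nat; congr (u p _).
  rewrite [RHS]presented_actE; apply: tclass_eq => Z z sol.
  by rewrite /= compm1.
Qed.

Lemma presented_hom_eq (Y : qmod Q A) (u v : qhom presented Y) :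
  (forall j, u q (gen j) = v q (gen j)) -> forall p x, u p x = v p x.
Proof.
move=> uv p x; have [t <-] := tclass_surj x.
have uv_gen : (fun j => u q (gen j)) = (fun j => v q (gen j)) by exact: funext.
by rewrite !presented_hom_eval uv_gen.
Qed.

Lemma solution_gen : solution gen.
Proof.
move=> i; set x := \sum_j _.
have [t tx] := tclass_surj x.
rewrite -tx -[0]/(tclass Tzero); apply: tclass_eq => Y y sol.
have [u uE] := presented_hom sol.
have -> : eval y t = u q (tclass t).
  have -> : y = fun j => u q (gen j) by apply: funext => j; rewrite uE.
  by rewrite presented_hom_eval.
rewrite tx /= linear_sum -[RHS](sol i).
by apply: eq_bigr => j _; rewrite linearZ /= uE.
Qed.

Lemma solution_hom (Y : qmod Q A) (u : qhom presented Y) :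
  solution (fun j => u q (gen j)).
Proof.
move=> i; rewrite -[RHS](linear0 (u q)) -(solution_gen i) linear_sum.
by apply: eq_bigr => j _; rewrite linearZ.
Qed.
End Presentation.

(** * Products and quotients of functors *)

Section QmodConstructions.
Variables (k : comPzRingType) (Q : linCat k) (A : algebra k).

Section QProduct.
Variables (T : Type) (X : T -> qmod Q A).

Lemma qprod_act_linear p p' (f : mor Q p p') :
  linear (fun x : dprod (fun t => X t p) =>
            (fun t => qact (X t) f (x t)) : dprod (fun t => X t p')).
Proof.
by move=> c x y; apply: functional_extensionality_dep => t; exact: linearP.
Qed.

Definition qprod : qmod Q A.
Proof.
refine (@QMod k Q A (fun p => dprod (fun t => X t p))
          (fun p p' f => linear_of (qprod_act_linear f)) _ _ _).
- by move=> p x; apply: functional_extensionality_dep => t; exact: qact1.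
- move=> p p' p'' g f x; apply: functional_extensionality_dep => t.
  exact: qactM.
- move=> p p' c f g x; apply: functional_extensionality_dep => t.
  exact: qact_linear.
Defined.
End QProduct.

Section QQuotient.
Variables (X : qmod Q A) (P : forall p, X p -> Prop).
Hypotheses (subP : forall p, is_submodule (@P p))
  (actP : forall p p' (f : mor Q p p') x, P x -> P (qact X f x)).

Lemma qquot_eq p p' (f : mor Q p p') (x y : coset_premodule (subP p)) :
  peq x y -> coset (subP p') (qact X f x) = coset (subP p') (qact X f y).
Proof.
move=> xy; apply/eqP; rewrite -subr_eq0 -!linearB /=; apply/eqP/coset_eq0.
exact: actP.
Qed.

Definition qquot_act p p' (f : mor Q p p') :
  {linear cosets (subP p) -> cosets (subP p')}.
Proof.
refine (@lift_quot A (coset_premodule (subP p)) (cosets (subP p'))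
  (fun x => coset (subP p') (qact X f x)) (@qquot_eq p p' f) _ _).
- by move=> x y; rewrite -linearD -linearD.
- by move=> c x; rewrite -linearZ -linearZ.
Defined.

Lemma qquot_actE p p' (f : mor Q p p') x :
  qquot_act f (coset (subP p) x) = coset (subP p') (qact X f x).
Proof. exact: lift_class. Qed.

Definition qquot : qmod Q A.
Proof.
refine (@QMod k Q A (fun p => cosets (subP p)) qquot_act _ _ _).
- by move=> p y; have [x <-] := coset_surj y; rewrite qquot_actE qact1.
- move=> p p' p'' g f y; have [x <-] := coset_surj y.
  by rewrite !qquot_actE qactM.
- move=> p p' c f g y; have [x <-] := coset_surj y.
  by rewrite !qquot_actE qact_linear linearP.
Defined.

Definition qquot_prj : qhom X qquot.
Proof.
refine (@QHom k Q A X qquot (fun p => coset (subP p)) _).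
by move=> p p' f x; exact: (esym (qquot_actE f x)).
Defined.
End QQuotient.

Definition qcompose (X Y Z : qmod Q A) (v : qhom Y Z) (u : qhom X Y) : qhom X Z.
Proof.
refine (@QHom k Q A X Z (fun p => (v p \o u p : {linear X p -> Z p})) _).
by move=> p p' f x; rewrite /= !qhom_nat.
Defined.

Definition qzero (X Y : qmod Q A) : qhom X Y.
Proof.
refine (@QHom k Q A X Y (fun p => (\0 : {linear X p -> Y p})) _).
by move=> p p' f x; rewrite /= linear0.
Defined.

Lemma epi_surjective (X Y : qmod Q A) (g : qhom X Y) :
  (forall p y, exists x, g p x = y) -> epi g.
Proof. by move=> g_surj Z u v uv p y; have [x <-] := g_surj p y. Qed.

(** An element of X(p) is a morphism into X from the free functor on one
    generator at p. *)
Lemma mono_injective (X Y : qmod Q A) (g : qhom X Y) :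
  mono g -> forall p, injective (g p).
Proof.
move=> mono_g p x y gxy.
have nosol (z : 'I_1 -> X p) :
    solution (I := 'I_0) (fun _ _ => 0) z by case.
have [u uE] := presented_hom (nosol (fun _ => x)).
have [v vE] := presented_hom (nosol (fun _ => y)).
rewrite -(uE ord0) -(vE ord0); apply: mono_g => q z.
rewrite -[LHS]/(qcompose g u q z) -[RHS]/(qcompose g v q z).
by apply: presented_hom_eq => j; rewrite /= uE vE.
Qed.
End QmodConstructions.

(** * Direct limits and finite presentation *)

Section DirectLimit.
Variables (k : comPzRingType) (Q : linCat k) (A : algebra k).
Variable D : direct_system Q A.

Lemma ds_upper_bound (J : finType) (f : J -> ds_index D) :
  exists l, forall j, ds_le (f j) l.
Proof.
suff [l lP] : exists l, forall j, j \in enum J -> ds_le (f j) l.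
  by exists l => j; apply: lP; rewrite mem_enum.
elim: (enum J) => [|j s [l lP]]; first by have [i _] := ds_nonempty D; exists i.
have [m [jm lm]] := ds_directed (f j) l.
exists m => j'; rewrite inE => /orP[/eqP -> // | /lP j'l].
exact: ds_trans lm.
Qed.

Variables (C : qmod Q A) (c : forall i, qhom (D i) C).
Hypothesis limC : is_direct_limit c.

Lemma limit_cocone i j (le_ij : ds_le i j) p x :
  c j p (ds_map le_ij p x) = c i p x.
Proof. exact: limC.1. Qed.

(** The projection to the quotient by the union of the images and the zero map
    both kill every D(i), so they are equal. *)
Lemma limit_surjective p (y : C p) : exists i x, c i p x = y.
Proof.
pose P p (y : C p) := exists i x, c i p x = y.
have subP p' : is_submodule (@P p').
  split=> [|_ _ [i [x <-]] [j [y' <-]]|a _ [i [x <-]]].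
  - by have [i _] := ds_nonempty D; exists i, 0; rewrite linear0.
  - have [l [il jl]] := ds_directed i j.
    exists l, (ds_map il p' x + ds_map jl p' y').
    by rewrite linearD !limit_cocone.
  - by exists i, (a *: x); rewrite linearZ.
have actP p' p'' (f : mor Q p' p'') x : P p' x -> P p'' (qact C f x).
  by move=> [i [z <-]]; exists i, (qact (D i) f z); rewrite qhom_nat.
pose prj := qquot_prj subP actP.
apply/(coset_eq0 (subP p)); rewrite -[LHS]/(prj p y).
have [_] :=
  limC.2 _ (fun i => qzero (D i) (qquot subP actP)) (fun _ _ _ _ _ => erefl).
move=> /(_ prj (qzero _ _)); apply=> // i q x.
by apply/coset_eq0; exists i, x.
Qed.

(** The families indexed by the system, up to equality at all large indices,
    form a cocone that only kills what is killed at a later stage. *)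
Lemma limit_eq0 i p (x : D i p) :
  c i p x = 0 -> exists j (le_ij : ds_le i j), ds_map le_ij p x = 0.
Proof.
move=> cx0.
pose X := qprod (fun j => D j).
pose P p (f : X p) := exists j0, forall j, ds_le j0 j -> f j = 0.
have subP p' : is_submodule (@P p').
  split=> [|f g [j fj] [l gl]|a f [j fj]].
  - by have [j _] := ds_nonempty D; exists j.
  - have [m [jm lm]] := ds_directed j l.
    exists m => n mn; rewrite -[LHS]/(f n + g n) fj ?gl ?addr0 //.
      exact: ds_trans mn.
    exact: ds_trans mn.
  - by exists j => n jn; rewrite -[LHS]/(a *: f n) fj // scaler0.
have actP p' p'' (g : mor Q p' p'') f : P p' f -> P p'' (qact X g f).
  by move=> [j fj]; exists j => n jn; rewrite /= fj // linear0.
pose tail i' p' (x' : D i' p') : X p' := fun j =>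
  if pselect (ds_le i' j) is left le then ds_map le p' x' else 0.
have tail_linear i' p' : linear (@tail i' p').
  move=> a y z; apply: functional_extensionality_dep => j.
  rewrite [RHS](_ : _ = a *: tail i' p' y j + tail i' p' z j) // /tail.
  by case: pselect => le; [exact: linearP | rewrite scaler0 addr0].
pose zc i' p' : {linear D i' p' -> cosets (subP p')} :=
  (coset (subP p') \o linear_of (@tail_linear i' p')).
have zc_nat i' p' p'' (f : mor Q p' p'') y :
    zc i' p'' (qact (D i') f y) = qact (qquot subP actP) f (zc i' p' y).
  rewrite [RHS]qquot_actE; congr (coset _ _).
  apply: functional_extensionality_dep => j; rewrite /= /tail.
  by case: pselect => le; rewrite ?qhom_nat ?linear0.
pose z i' : qhom (D i') (qquot subP actP) :=
  @QHom k Q A (D i') (qquot subP actP) (zc i') (@zc_nat i').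
have z_cocone : is_cocone z.
  move=> i' j le_ij p' y; apply/eqP; rewrite -subr_eq0; apply/eqP.
  transitivity (coset (subP p') (tail j p' (ds_map le_ij p' y) - tail i' p' y)).
    by rewrite linearB.
  apply/coset_eq0; exists j => n jn.
  rewrite [LHS](_ : _ = tail j p' (ds_map le_ij p' y) n - tail i' p' y n) //.
  rewrite /tail; case: pselect => // le_jn.
  case: pselect => [le_in | []]; last exact: ds_trans jn.
  by rewrite (ds_mapM le_ij le_jn le_in) subrr.
have [[h hz] _] := limC.2 _ z z_cocone.
have : z i p x = 0 by rewrite -hz cx0 linear0.
move=> /coset_eq0[j0 j0P].
have [j [j0j ij]] := ds_directed j0 i.
have := j0P j j0j; rewrite /= /tail; case: pselect => // le_ij xj0.
by exists j, le_ij.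
Qed.

Lemma limit_eq0_family (J : finType) i p (x : J -> D i p) :
  (forall t, c i p (x t) = 0) ->
  exists j (le_ij : ds_le i j), forall t, ds_map le_ij p (x t) = 0.
Proof.
move=> cx0; have /choice[f fP] t := limit_eq0 (cx0 t).
have [l lP] := ds_upper_bound f; have [m [lm im]] := ds_directed l i.
exists m, im => t; have [ift xt0] := fP t.
by rewrite (ds_mapM ift (ds_trans (lP t) lm)) xt0 linear0.
Qed.
End DirectLimit.

(** Maps out of the functor are finite solutions at [q] of finitely many
    equations: the entries of a solution in the limit, and then the equations,
    already come from a stage of the system. *)
Theorem presented_finitely_presented (k : comPzRingType) (Q : linCat k)
    (A : algebra k) (q : Q) (I J : finType) (a : I -> J -> A) :
  finitely_presented (presented q a).
Proof.
move=> D C c limC; split=> [u | i v v' cvv'].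
  have ex t := limit_surjective limC (u q (gen q a t)).
  pose f t := sval (cid (ex t)); pose x t := sval (cid (svalP (cid (ex t)))).
  have xP t : c (f t) q (x t) = u q (gen q a t).
    exact: svalP (cid (svalP (cid (ex t)))).
  have [l fl] := ds_upper_bound f.
  pose y t := ds_map (fl t) q (x t).
  have yP t : c l q (y t) = u q (gen q a t) by rewrite limit_cocone.
  have [s|m [lm ym]] := limit_eq0_family
    (x := fun s => \sum_t a s t *: y t) limC.
    rewrite linear_sum -[RHS](solution_hom u s).
    by apply: eq_bigr => t _; rewrite linearZ /= yP.
  have [s|v vP] :=
    @presented_hom _ _ _ q _ _ a (D m) (fun t => ds_map lm q (y t)).
    rewrite -[RHS](ym s) linear_sum.
    by apply: eq_bigr => t _; rewrite linearZ.
  exists m, v => p t; rewrite -[RHS]/(qcompose (c m) v p t).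
  by apply: presented_hom_eq => j; rewrite /= vP limit_cocone.
have [t|m [im vm]] := limit_eq0_family (i := i)
    (x := fun t => v q (gen q a t) - v' q (gen q a t)) limC.
  by rewrite linearB cvv' subrr.
exists m, im => p t.
rewrite -[LHS]/(qcompose (ds_map im) v p t).
rewrite -[RHS]/(qcompose (ds_map im) v' p t).
apply: presented_hom_eq => j; apply/eqP; rewrite -subr_eq0 /= -linearB.
exact/eqP/vm.
Qed.

(** * Coinduced functors *)

Section Coinduction.
Variables (k : comPzRingType) (Q : linCat k) (A : algebra k) (q : Q).

Section Object.
Variable C : lmodType A.

Definition klinear (p : Q) (phi : dprod (fun _ : mor Q p q => C)) : Prop :=
  forall c f g, phi (c *: f + g) = alg_str A c *: phi f + phi g.

Lemma klinear_submodule p : is_submodule (@klinear p).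
Proof.
split=> [c f g|phi psi phiL psiL c f g|a phi phiL c f g].
- by rewrite [RHS](_ : _ = alg_str A c *: 0 + 0) // scaler0 addr0.
- by rewrite [LHS](congr2 +%R (phiL _ _ _) (psiL _ _ _)) addrACA -scalerDr.
- rewrite [LHS](congr1 ( *:%R a) (phiL _ _ _)) scalerDr scalerA -alg_central.
  by rewrite -scalerA.
Qed.

Definition coind_ob (p : Q) : lmodType A := submod (@klinear_submodule p).

Definition coind_val p (phi : coind_ob p) : mor Q p q -> C :=
  submod_val (subP := @klinear_submodule p) phi.

Lemma coind_val_linear p (phi : coind_ob p) c f g :
  coind_val phi (c *: f + g) = alg_str A c *: coind_val phi f + coind_val phi g.
Proof. exact: (submodP (subP := @klinear_submodule p) phi). Qed.

Lemma coind_eq p (phi psi : coind_ob p) :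
  coind_val phi =1 coind_val psi -> phi = psi.
Proof.
move=> eq_app; apply: (@submod_val_inj _ _ _ (@klinear_submodule p)).
exact: functional_extensionality_dep eq_app.
Qed.

Definition coind_elt p (phi : mor Q p q -> C)
    (phiL : forall c f g, phi (c *: f + g) = alg_str A c *: phi f + phi g) :
  coind_ob p := in_submod (@klinear_submodule p) (x := phi) phiL.

Lemma coind_val_comp_linear p p' (g : mor Q p p') (phi : coind_ob p) c f f' :
  coind_val phi (cmp Q (c *: f + f') g) =
  alg_str A c *: coind_val phi (cmp Q f g) + coind_val phi (cmp Q f' g).
Proof. by rewrite comp_linearl coind_val_linear. Qed.

Lemma coind_act_linear p p' (g : mor Q p p') :
  linear (fun phi : coind_ob p => coind_elt (coind_val_comp_linear g phi)).
Proof. by move=> a phi psi; apply: coind_eq. Qed.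

(** The right adjoint of evaluation at [q]: p |-> Hom_k(Q(p,q), C). *)
Definition coind : qmod Q A.
Proof.
refine (@QMod k Q A coind_ob (fun p p' g => linear_of (coind_act_linear g))
          _ _ _).
- move=> p phi; apply: coind_eq => f.
  by rewrite [LHS](_ : _ = coind_val phi (cmp Q f (idm Q p))) // compm1.
- move=> p p' p'' g f phi; apply: coind_eq => h.
  exact: (congr1 (coind_val phi) (compA h g f)).
- move=> p p' c f g phi; apply: coind_eq => h.
  exact: etrans (congr1 (coind_val phi) (comp_linearr _ _ _ _))
    (coind_val_linear _ _ _ _).
Defined.

Lemma coind_val_act p p' (g : mor Q p p') (phi : coind p) f :
  coind_val (qact coind g phi) f = coind_val phi (cmp Q f g).
Proof. by []. Qed.

Lemma counit_linear : linear (fun phi : coind q => coind_val phi (idm Q q)).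
Proof. by []. Qed.

Definition counit : {linear coind q -> C} := linear_of counit_linear.

Section Transpose.
Variables (X : qmod Q A) (g : {linear X q -> C}).

Lemma transpose_klinear p (x : X p) c (f f' : mor Q p q) :
  g (qact X (c *: f + f') x) =
  alg_str A c *: g (qact X f x) + g (qact X f' x).
Proof. by rewrite qact_linear linearP. Qed.

Lemma transpose_linear p :
  linear (fun x : X p => coind_elt (transpose_klinear x) : coind p).
Proof.
move=> a x y; apply: coind_eq => f.
rewrite [LHS](_ : _ = g (qact X f (a *: x + y))) // linearP.
exact: linearP.
Qed.

Definition transpose : qhom X coind.
Proof.
refine (@QHom k Q A X coind (fun p => linear_of (@transpose_linear p)) _).
move=> p p' f x; apply: coind_eq => h.
by rewrite [LHS](_ : _ = g (qact X h (qact X f x))) // -qactM.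
Defined.

Lemma coind_val_transpose p (x : X p) f :
  coind_val (transpose p x) f = g (qact X f x).
Proof. by []. Qed.
End Transpose.

(** Evaluation preserves monomorphisms, so its right adjoint preserves
    injectives. *)
Lemma coind_injective : inj_module C -> injective_object coind.
Proof.
move=> injC X Y g f mono_g.
have [h hP] :=
  inj_module_extend (counit \o f q) injC (mono_injective mono_g (p := q)).
exists (transpose h) => p x; apply: coind_eq => s.
rewrite coind_val_transpose -qhom_nat hP /= qhom_nat.
by rewrite [LHS]coind_val_act comp1m.
Qed.
End Object.

Section Map.
Variables (C D : lmodType A) (g : {linear C -> D}).

Definition coind_map : qhom (coind C) (coind D) :=
  transpose (X := coind C) (g \o counit C).

Lemma coind_val_map p (phi : coind C p) f :
  coind_val (coind_map p phi) f = g (coind_val phi f).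
Proof. by rewrite coind_val_transpose /= coind_val_act comp1m. Qed.
End Map.

Definition restr_map (C D : lmodType A) (g : {linear C -> D}) :
  {linear restr_scalars C -> restr_scalars D}.
Proof.
exact: (@linear_of k (restr_scalars C) (restr_scalars D) g
  (fun c x y => linearP g (alg_str A c) x y)).
Defined.

(** A preimage is a lift of a k-linear map from the projective module Q(p,q). *)
Lemma coind_map_surjective (C D : lmodType A) (g : {linear C -> D}) p :
  projective_module (mor Q p q) -> (forall d, exists c, g c = d) ->
  forall psi, exists phi, coind_map g p phi = psi.
Proof.
move=> projQ g_surj psi.
pose psi' : {linear mor Q p q -> restr_scalars D} :=
  @linear_of k (mor Q p q) (restr_scalars D) (coind_val psi)
    (coind_val_linear psi).
have [phi phiP] := projQ _ _ (restr_map g) psi' g_surj.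
exists (@coind_elt C p phi (fun c f f' => linearP phi c f f')).
by apply: coind_eq => f; rewrite coind_val_map; exact: phiP.
Qed.
End Coinduction.

(** * Injective dimension of coinduced functors *)

Section InjectiveDimension.
Variables (k : comPzRingType) (Q : linCat k) (A : algebra k) (q : Q).
Variable C : lmodType A.
Hypotheses (hered : hereditary k)
  (projQ : forall p, projective_module (mor Q p q)).

Variables (I0 : lmodType k) (i : {linear (restr_scalars C : lmodType k) -> I0}).
Hypotheses (injI0 : inj_module I0) (inj_i : injective i).

(** The zero modules in degrees at least 2 are empty products. *)
Definition resol (n : nat) : lmodType (base_algebra k) :=
  match n with
  | 0 => I0
  | 1 => cosets (in_range_submodule i)
  | _ => dprod (fun _ : void => I0)
  end.

Definition resol_map n : {linear resol n -> resol n.+1} :=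
  match n return {linear resol n -> resol n.+1} with
  | 0 => coset (in_range_submodule i)
  | _ => \0
  end.

Lemma resol_injective n : inj_module (resol n).
Proof.
case: n => [|[|n]] //=; last by apply: inj_module_dprod; case.
apply: (hereditary_quotient_injective (p := coset (in_range_submodule i)))
  => //.
exact: coset_surj.
Qed.

Lemma augmentation_klinear p (phi : forget (coind q C) p) c (f g : mor Q p q) :
  i (coind_val (phi : coind q C p) (c *: f + g)) =
  (c : k) *: i (coind_val (phi : coind q C p) f) +
  i (coind_val (phi : coind q C p) g).
Proof. by rewrite coind_val_linear; exact: (linearP i). Qed.

Definition augmentation_elt p (phi : forget (coind q C) p) :
    coind q (resol 0) p :=
  @coind_elt k Q (base_algebra k) q I0 p _ (augmentation_klinear phi).

Lemma augmentation_linear p : linear (@augmentation_elt p).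
Proof.
move=> c phi psi; apply: (@coind_eq k Q (base_algebra k)) => f.
exact: (linearP i).
Qed.

Definition augmentation : qhom (forget (coind q C)) (coind q (resol 0)).
Proof.
refine (@QHom k Q (base_algebra k) _ _
          (fun p => linear_of (@augmentation_linear p)) _).
by move=> p p' f phi; apply: (@coind_eq k Q (base_algebra k)).
Defined.

Lemma resol_zero n p (phi : coind q (resol n.+2) p) : phi = 0.
Proof.
apply: (@coind_eq k Q (base_algebra k)) => f.
by apply: functional_extensionality_dep; case.
Qed.

(** Coinduction is exact because Q(p,q) is projective, so it turns the
    resolution 0 -> C -> I0 -> I0/C -> 0 over the hereditary ring into one
    by injective functors. *)
Lemma finite_id_coind : finite_id (forget (coind q C)).
Proof.
exists (fun n => coind q (resol n)), (fun n => coind_map q (resol_map n)),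
  augmentation.
split=> [n|p phi psi phipsi|p psi|n p psi|].
- exact/coind_injective/resol_injective.
- apply: (@coind_eq k Q A) => f; apply: inj_i.
  exact: (congr1 (fun z : coind q (resol 0) p => coind_val z f) phipsi).
- split=> [dpsi0|[phi <-]]; last first.
    apply: (@coind_eq k Q (base_algebra k)) => f; rewrite coind_val_map.
    by apply/coset_eq0; exists (coind_val (phi : coind q C p) f).
  have /choice[phi phiP] f : in_range i (coind_val psi f).
    apply/(coset_eq0 (in_range_submodule i)).
    by rewrite -(coind_val_map (resol_map 0)) dpsi0.
  have phiL c f g :
      (phi : _ -> C) (c *: f + g) = alg_str A c *: (phi f : C) + phi g.
    apply: inj_i; rewrite phiP coind_val_linear -!phiP.
    by rewrite [RHS](linearP i c).
  exists (coind_elt phiL : coind q C p).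
  by apply: (@coind_eq k Q (base_algebra k)) => f; rewrite -phiP.
- split=> [_|_]; last first.
    by apply: (@coind_eq k Q (base_algebra k)) => f; rewrite coind_val_map.
  case: n psi => [|n] psi.
    by apply: coind_map_surjective => //; exact: coset_surj.
  by exists 0; rewrite linear0 [RHS]resol_zero.
- by exists 1%N => -[|[|n]] // _ p x; exact: resol_zero.
Qed.
End InjectiveDimension.

(** * Extending characters along pure submodules *)

Section Spread.
Variable W : zmodType.

(** The finitely supported function on [W] given by a list of values; the values
    listed at the same point are added. *)
Definition spread (V : zmodType) (s : seq (W * V)) (w : W) : V :=
  \sum_(p <- s | p.1 == w) p.2.

Lemma spread_cons (V : zmodType) p (s : seq (W * V)) w :
  spread (p :: s) w = (if p.1 == w then p.2 else 0) + spread s w.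
Proof. by rewrite /spread big_cons; case: ifP; rewrite ?add0r. Qed.

Lemma sum_spread (V T : zmodType) (B : W -> {additive V -> T})
    (supp : seq W) (s : seq (W * V)) :
  uniq supp -> {subset map fst s <= supp} ->
  \sum_(w <- supp) B w (spread s w) = \sum_(p <- s) B p.1 p.2.
Proof.
move=> supp_uniq; elim: s => [_|p s IHs sub].
  by rewrite big_nil big1 // => w _; rewrite /spread big_nil raddf0.
have p_supp : p.1 \in supp by apply: sub; rewrite mem_head.
rewrite big_cons -IHs => [|w ws]; last by apply: sub; rewrite inE ws orbT.
rewrite (eq_bigr (fun w =>
    (if w == p.1 then B w p.2 else 0) + B w (spread s w))).
  by rewrite big_split -big_mkcond /= -big_filter filter_pred1_uniq // big_seq1.
move=> w _; rewrite spread_cons raddfD eq_sym.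
by case: eqP => // _; rewrite raddf0.
Qed.
End Spread.

Lemma int_submodule (V : lmodType int) (P : V -> Prop) :
  P 0 -> (forall x y, P x -> P y -> P (x + y)) -> (forall x, P x -> P (- x)) ->
  is_submodule P.
Proof.
move=> P0 PD PN; split=> // c x Px.
have Pn (n : nat) : P (n%:Z *: x).
  elim: n => [|n IHn]; first by rewrite scale0r.
  by rewrite intS scalerDl scale1r; exact: PD.
by case: c => n; [|rewrite NegzE scaleNr; apply: PN].
Qed.

Section Pure.
Variable A : pzRingType.

(** Purity in terms of equations: a finite linear system with constants in [V]
    that is solvable in [W] is solvable in [V]. *)
Definition pure_map (V W : lmodType A) (i : {linear V -> W}) : Prop :=
  forall (I J : finType) (a : I -> J -> A) (x : I -> V) (z : J -> W),
    (forall s, \sum_t a s t *: z t = i (x s)) ->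
    exists y : J -> V, forall s, \sum_t a s t *: y t = x s.

Variables (N : lmodType A^c) (P : N -> Prop).
Hypothesis subP : is_submodule P.

Definition vanishes (chi : charm N) : Prop :=
  forall n, P n -> char_val chi n = 0.

Lemma vanishes_submodule : is_submodule vanishes.
Proof.
split=> [n _|chi chi' v v' n Pn|a chi v n Pn]; first exact: char_val_zero.
  by rewrite char_val_add v // v' // addr0.
by rewrite char_val_scale v //; exact: (submodZ subP (a : A^c) Pn).
Qed.

(** The characters of N/P. *)
Definition annihilator : lmodType A := submod vanishes_submodule.

Definition annihilator_val (chi : annihilator) : charm N :=
  submod_val (subP := vanishes_submodule) chi.

Definition weight (s : seq (N * A)) : N := \sum_(p <- s) (p.2 : A^c) *: p.1.

Section Extension.
Variables (V W : lmodType A) (i : {linear V -> W}).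
Hypothesis pure_i : pure_map i.
Variable alpha : {linear V -> annihilator}.

Let val (x : V) (n : N) : QZ := char_val (annihilator_val (alpha x)) n.

Let valD n : forall x y, val (x + y) n = val x n + val y n.
Proof. by move=> x y; rewrite /val linearD. Qed.
Let val0 n : val 0 n = 0.
Proof. by rewrite /val linear0. Qed.
Let valN n x : val (- x) n = - val x n.
Proof. by rewrite /val linearN. Qed.
Let valZ n (a : A) x : val (a *: x) n = val x ((a : A^c) *: n).
Proof. by rewrite /val linearZ. Qed.
Let val_sum x (T : Type) (r : seq T) (F : T -> N) :
  val x (\sum_(j <- r) F j) = \sum_(j <- r) val x (F j).
Proof. exact: (big_morph (val x) (char_valD _) (char_val0 _)). Qed.

Let functions : lmodType int :=
  zmodule (dprod (fun _ : N => W)).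

(* A finitely supported function N -> W represents a tensor of (N/P) (x) W;
   [t] stands for a tensor of elements of V, where the value is prescribed, and
   each pair [s j], [e j] for a relation, of value 0. *)
Let graph (p : functions * QZ) : Prop :=
  exists (t : seq (N * V)) (J : finType) (s : J -> seq (N * A)) (e : J -> W),
    [/\ forall j, P (weight (s j)),
        forall n, (p.1 : dprod _) n =
          i (spread t n) + \sum_j spread (s j) n *: e j
      & p.2 = \sum_(q <- t) val q.2 q.1].

Let graph_submodule : is_submodule graph.
Proof.
apply: int_submodule.
- exists [::], 'I_0, (fun _ => [::]), (fun _ => 0).
  split=> [[] // | n | ]; last by rewrite big_nil.
  by rewrite big_ord0 addr0 /spread big_nil [RHS]linear0.
- move=> p p' [t [J [s [e [Ps sum_s val_t]]]]].
  move=> [t' [J' [s' [e' [Ps' sum_s' val_t']]]]].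
  exists (t ++ t'), (J + J')%type, (sum_rect _ s s'), (sum_rect _ e e').
  split=> [[]// | n | ]; last by rewrite big_cat /= val_t val_t'.
  rewrite [LHS](congr2 +%R (sum_s n) (sum_s' n)) big_sumType /=.
  by rewrite /spread big_cat linearD addrACA.
- move=> p [t [J [s [e [Ps sum_s val_t]]]]].
  exists [seq (q.1, - q.2) | q <- t], J, s, (fun j => - e j); split=> // [n|].
    rewrite [LHS](congr1 -%R (sum_s n)) opprD -linearN; congr (i _ + _).
      by rewrite /spread big_map sumrN.
    by rewrite -sumrN; apply: eq_bigr => j _; rewrite scalerN.
  by rewrite /= val_t big_map -sumrN; apply: eq_bigr => q _; rewrite valN.
Qed.

Let graph_single_valued : single_valued graph.
Proof.
move=> c [t [J [s [e [Ps sum0 /= ->]]]]].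
(* The finitely many elements of N that are involved index the equations of
   the system whose solution [e] in W is moved into V by purity. *)
pose supp := undup (map fst t ++ flatten [seq map fst (s j) | j <- enum J]).
have supp_t : {subset map fst t <= supp}.
  by move=> w wt; rewrite mem_undup mem_cat wt.
have supp_s j : {subset map fst (s j) <= supp}.
  move=> w ws; rewrite mem_undup mem_cat; apply/orP; right.
  by apply/flattenP; exists (map fst (s j)) => //; apply/mapP; exists j;
    rewrite ?mem_enum.
pose a (m : 'I_(size supp)) j := spread (s j) (tnth (in_tuple supp) m).
pose x (m : 'I_(size supp)) := - spread t (tnth (in_tuple supp) m).
have [m|y yP] := pure_i (a := a) (x := x) (z := e).
  have sum_m : i (spread t (tnth (in_tuple supp) m)) + \sum_j a m j *: e j = 0.
    exact/esym/sum0.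
  by apply/eqP; rewrite linearN -addr_eq0 addrC; apply/eqP.
transitivity (\sum_(n <- supp) additive_of (valD n) (spread t n)).
  by rewrite (sum_spread (fun n => additive_of (valD n)) (undup_uniq _) supp_t).
rewrite big_tnth /=.
rewrite (eq_bigr (fun m => - \sum_j val (y j)
    ((a m j : A^c) *: tnth (in_tuple supp) m))); last first.
  move=> m _; rewrite -[spread _ _]opprK -/(x m) -yP valN; congr (- _).
  rewrite (big_morph (val^~ _) (valD _) (val0 _)).
  by apply: eq_bigr => j _; rewrite valZ.
rewrite sumrN exchange_big /= big1 ?oppr0 // => j _.
rewrite -val_sum.
have -> : \sum_(m < size supp) (a m j : A^c) *: tnth (in_tuple supp) m =
    weight (s j).
  pose B n : {additive A -> N} :=
    additive_of (fun c d : A => scalerDl n (c : A^c) d).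
  transitivity (\sum_(n <- supp) B n (spread (s j) n));
    first by rewrite [RHS]big_tnth.
  by rewrite (sum_spread B (undup_uniq _) (supp_s j)).
exact: (submodP (subP := vanishes_submodule) (alpha (y j))).
Qed.

Let delta (n : N) (z : W) : functions := spread [:: (n, z)].

Let deltaE n z m : (delta n z : dprod _) m = if n == m then z else 0.
Proof. by rewrite /delta spread_cons /spread big_nil addr0. Qed.

Let deltaD n z z' : delta n (z + z') = delta n z + delta n z'.
Proof.
apply: functional_extensionality_dep => m.
rewrite [RHS](_ : _ = (delta n z : dprod _) m + (delta n z' : dprod _) m) //.
by rewrite !deltaE; case: eqP; rewrite ?addr0.
Qed.

(** In the group of finitely supported functions N -> W, which stand for
    elements of N (x) W, the prescribed values on N (x) V and the relations of
    (N/P) (x) W determine a partial character. It is single-valued because a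
    relation that holds in W among elements of V already holds in V. *)
Lemma pure_extension : exists beta : {linear W -> annihilator},
  forall x, beta (i x) = alpha x.
Proof.
have [Phi PhiP] := QZ_injective graph_submodule graph_single_valued.
have PhiN n z : Phi (delta n (- z)) = - Phi (delta n z).
  apply/eqP; rewrite -addr_eq0 -linearD -deltaD addNr.
  rewrite (_ : delta n 0 = 0) ?linear0 //.
  by apply: functional_extensionality_dep => m; rewrite [LHS]deltaE; case: eqP.
have PhiV x n : Phi (delta n (i x)) = val x n.
  apply: PhiP; exists [:: (n, x)], 'I_0, (fun _ => [::]), (fun _ => 0).
  split=> [[] // | m | ]; last by rewrite big_seq1.
  rewrite big_ord0 addr0 [LHS]deltaE spread_cons /spread big_nil addr0.
  by case: eqP => // _; rewrite linear0.
have PhiP0 (s : seq (N * A)) z : P (weight s) ->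
    \sum_(p <- s) Phi (delta p.1 (p.2 *: z)) = 0.
  move=> Ps; rewrite -linear_sum; apply: PhiP.
  exists [::], 'I_1, (fun _ => s), (fun _ => z); split=> // [n|]; last first.
    by rewrite big_nil.
  rewrite big_ord1 /spread big_nil linear0 add0r scaler_suml /=.
  elim: (s) => [|p r IHr]; first by rewrite !big_nil.
  rewrite !big_cons [LHS](_ : _ = (delta p.1 (p.2 *: z) : dprod _) n +
    (\sum_(q <- r) delta q.1 (q.2 *: z) : dprod _) n) //.
  by rewrite IHr [X in X + _]deltaE; case: eqP; rewrite ?add0r.
have betaD z n m : Phi (delta (n + m) z) = Phi (delta n z) + Phi (delta m z).
  (* The relation (n + m) (x) z = n (x) z + m (x) z. *)
  have := PhiP0 [:: (n + m, -1); (n, 1); (m, 1)] z.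
  rewrite /weight !big_cons !big_nil /= !addr0 !scale1r !scaleN1r PhiN.
  rewrite addNr => /(_ (submod0 subP)) /(canRL (addKr _)).
  by rewrite opprK addr0 => ->.
have betaV z n : P n -> Phi (delta n z) = 0.
  move=> Pn; have := PhiP0 [:: (n, 1)] z.
  by rewrite /weight !big_seq1 /= !scale1r; apply.
pose beta z : annihilator :=
  in_submod vanishes_submodule (x := character (betaD z)) (betaV z).
have beta_linear : linear beta.
  move=> a z z'; apply: (@submod_val_inj _ _ _ vanishes_submodule).
  apply: charm_eq => n.
  rewrite [LHS](_ : _ = Phi (delta n (a *: z + z'))) //.
  rewrite [RHS](_ : _ = Phi (delta ((a : A^c) *: n) z) + Phi (delta n z')) //.
  rewrite deltaD linearD; congr (_ + _).
  (* The relation n (x) a z = n a (x) z. *)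
  have := PhiP0 [:: (n, a); ((a : A^c) *: n, -1)] z.
  rewrite /weight !big_cons !big_nil /= !addr0 !scaleN1r PhiN.
  by rewrite subrr => /(_ (submod0 subP)) /eqP; rewrite subr_eq0 => /eqP.
exists (linear_of beta_linear) => x.
apply: (@submod_val_inj _ _ _ vanishes_submodule); apply: charm_eq => n.
exact: PhiV.
Qed.
End Extension.
End Pure.

(** * Cotorsion coinduced functors *)

Section Cotorsion.
Variables (k : comPzRingType) (Q : linCat k) (A : algebra k).

Lemma retraction_splits (M N : qmod Q A) (E : extension M N)
    (rho : qhom (ext_mid E) N) :
  (forall p n, rho p (ext_inc E p n) = n) -> ext_equiv E (split_extension M N).
Proof.
move=> rhoK.
have hlin p : linear (fun e : ext_mid E p => (rho p e, ext_prj E p e) :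
  dsum M N p).
  by move=> a x y; rewrite !linearP.
have hnat p p' (f : mor Q p p') e :
    linear_of (hlin p') (qact (ext_mid E) f e) =
    qact (dsum M N) f (linear_of (hlin p) e).
  by rewrite /= /dsum_act !qhom_nat.
exists (@QHom k Q A (ext_mid E) (dsum M N) (fun p => linear_of (hlin p)) hnat).
split=> [p n|//]; rewrite /= rhoK; congr pair.
by apply/ext_exact; exists n.
Qed.

(** Lifting elements of F(q) that satisfy given linear equations amounts to
    lifting a map out of a finitely presented functor. *)
Lemma flat_extension_pure (F N : qmod Q A) (E : extension F N) q :
  flat_object F -> pure_map (ext_inc E q).
Proof.
move=> flatF I J a x z eq_xz.
have [_ lift] := flatF _ (ext_prj E) (epi_surjective (@ext_surj _ _ _ _ _ E)).
have [s|u uP] := @presented_hom _ _ _ q _ _ a F (fun t => ext_prj E q (z t)).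
  transitivity (ext_prj E q (\sum_t a s t *: z t)).
    by rewrite linear_sum; apply: eq_bigr => t _; rewrite linearZ.
  by rewrite eq_xz; apply/ext_exact; exists (x s).
have [v vP] := lift _ (presented_finitely_presented q a) u.
have /choice[y yP] t : exists y, ext_inc E q y = z t - v q (gen q a t).
  by apply/ext_exact; rewrite linearB /= vP uP subrr.
exists y => s; apply: (ext_inj (e := E)).
rewrite -eq_xz linear_sum -[RHS]subr0 -[X in _ - X](solution_hom v s) -sumrB.
by apply: eq_bigr => t _; rewrite linearZ /= yP scalerBr.
Qed.

(** By adjunction, a retraction is the transpose of an extension of the counit
    along the pure map at [q]. *)
Theorem coind_annihilator_Cot q (N : lmodType A^c) (P : N -> Prop)
  (subP : is_submodule P) : @Cot k Q A (coind q (annihilator subP)).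
Proof.
move=> F flatF E.
have [beta betaP] := pure_extension
  (@flat_extension_pure _ _ E q flatF) (counit q (annihilator subP)).
apply: (@retraction_splits _ _ _ (transpose beta)) => p phi;
  apply: coind_eq => f.
by rewrite coind_val_transpose -qhom_nat betaP /= coind_val_act comp1m.
Qed.
End Cotorsion.

(** * Flatness of the values *)

Section Subfunctor.
Variables (k : comPzRingType) (Q : linCat k) (A : algebra k) (X : qmod Q A).
Variable P : forall p, X p -> Prop.
Hypotheses (subP : forall p, is_submodule (@P p))
  (actP : forall p p' (f : mor Q p p') x, P x -> P (qact X f x)).

Lemma qsub_act_linear p p' (f : mor Q p p') :
  linear (fun x : submod (subP p) =>
            in_submod (subP p') (actP f (submodP x))).
Proof. by move=> a x y; apply: submod_val_inj; exact: linearP. Qed.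

Definition qsub : qmod Q A.
Proof.
refine (@QMod k Q A (fun p => submod (subP p))
          (fun p p' f => linear_of (qsub_act_linear f)) _ _ _).
- by move=> p x; apply: submod_val_inj; exact: qact1.
- by move=> p p' p'' g f x; apply: submod_val_inj; exact: qactM.
- by move=> p p' c f g x; apply: submod_val_inj; exact: qact_linear.
Defined.

Definition qsub_val : qhom qsub X.
Proof.
by refine (@QHom k Q A qsub X (fun p => submod_val (subP := subP p)) _).
Defined.
End Subfunctor.

Section Lifting.
Variables (k : comPzRingType) (Q : linCat k) (A : algebra k).
Variables (X B B' N : qmod Q A) (i : qhom N B) (g : qhom B B') (u : qhom X B').
Hypotheses (inj_i : forall p, injective (i p)) (exact_g : exact_at i g)
  (surj_g : forall p y, exists x, g p x = y).

Let pull p (e : dsum X B p) : Prop := g p e.1 = u p e.2.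

Let pull_sub p : is_submodule (@pull p).
Proof.
split=> [|x y gx gy|c x gx]; rewrite /pull /=.
- by rewrite !linear0.
- by rewrite !linearD /= gx gy.
- by rewrite !linearZ /= gx.
Qed.

Let pull_act p p' (f : mor Q p p') x : pull x -> pull (qact (dsum X B) f x).
Proof. by rewrite /pull /= !qhom_nat => ->. Qed.

Let pullback : qmod Q A := qsub pull_sub pull_act.

Let pull_inc_in p (n : N p) : pull ((i p n, 0) : dsum X B p).
Proof.
by rewrite /pull /= linear0; apply/exact_g; exists n.
Qed.

Let pull_inc_linear p :
  linear (fun n : N p => in_submod (pull_sub p) (pull_inc_in n)).
Proof.
move=> a x y; apply: submod_val_inj.
by congr pair; rewrite ?linearP //= scaler0 addr0.
Qed.

Let pull_inc : qhom N pullback.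
Proof.
refine (@QHom k Q A N pullback (fun p => linear_of (@pull_inc_linear p)) _).
move=> p p' f n; apply: submod_val_inj.
by congr pair; rewrite /= ?qhom_nat ?linear0.
Defined.

Let pull_prj : qhom pullback X :=
  qcompose (dsum_prj X B) (qsub_val pull_sub pull_act).

Let pull_extension : extension X N.
Proof.
refine (@Extension k Q A X N pullback pull_inc pull_prj _ _ _).
- move=> p n n' /(congr1 (submod_val (subP := pull_sub p))) [].
  exact: inj_i.
- move=> p y; split=> [y0|[n <-] //].
  have gy : g p (submod_val y).1 = 0.
    rewrite (submodP y) -[RHS](linear0 (u p)); congr (u p _).
    exact: y0.
  have [n ny] := (exact_g _).1 gy; exists n; apply: submod_val_inj.
  by rewrite [RHS]surjective_pairing; congr pair; [exact: ny | exact/esym/y0].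
- move=> p x; have [b gb] := surj_g (u p x).
  by exists (in_submod (pull_sub p) (gb : pull ((b, x) : dsum X B p))).
Defined.

(** Vanishing of Ext(X, N) lets maps from X lift along an epimorphism with
    kernel N: a section of the pulled back extension gives such a lift. *)
Lemma Ext1_vanishes_lift : Ext1_vanishes X N ->
  forall p, exists h : {linear X p -> B p}, forall x, g p (h x) = u p x.
Proof.
move=> /(_ pull_extension)[h [h_inc h_prj]] p.
pose rho (e : pullback p) : N p := (h p e).1.
(* The component in B, corrected by the retraction [rho] so as to vanish on N:
   it only depends on the image of [e] in X(p). *)
pose lam (e : pullback p) : B p := (submod_val e).1 - i p (rho e).
have rho_linear : linear rho.
  by move=> a x y; exact: (congr1 fst (linearP (h p) a x y)).
have lam_linear : linear lam.
  move=> a x y; rewrite /lam rho_linear (linearP (i p)) opprD.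
  by rewrite scalerBr [RHS]addrACA.
have g_lam e : g p (lam e) = u p (pull_prj p e).
  rewrite linearB /= (submodP e) (_ : g p (i p (rho e)) = 0) ?subr0 //.
  by apply/exact_g; exists (rho e).
have lam0 e : pull_prj p e = 0 -> lam e = 0.
  move=> /(ext_exact (e := pull_extension))[n <-]; rewrite /lam /rho h_inc.
  exact: subrr.
have /choice[sec secP] := ext_surj pull_extension (q := p).
have lam_sec e : lam (sec (pull_prj p e)) = lam e.
  apply/eqP; rewrite -subr_eq0; apply/eqP.
  have lamB := linearB (linear_of lam_linear); rewrite -[LHS]lamB.
  by apply: lam0;
    rewrite linearB /= -[X in X - _]/(ext_prj pull_extension p _) secP subrr.
have lin : linear (fun x => lam (sec x)).
  move=> a x y; rewrite -[in LHS](secP x) -[in LHS](secP y).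
  rewrite -[a *: _ + _]linearP lam_sec; exact: lam_linear.
exists (linear_of lin) => x; rewrite /= g_lam; congr (u p _); exact: secP.
Qed.
End Lifting.

Lemma additive_int_linear (V W : lmodType int) (h : V -> W) :
  (forall x y, h (x + y) = h x + h y) -> linear h.
Proof.
move=> hD c x y; rewrite hD; congr (_ + _).
rewrite -[c in LHS]intz -[c in RHS]intz !scaler_int.
exact: (raddfMz (additive_of hD)).
Qed.

Section Flatness.
Variable A : pzRingType.

Section RestrictCharacter.
Variables (M N : lmodType A^c) (f : {linear M -> N}).

Lemma restrict_character_morph (chi : charm N) x y :
  char_val chi (f (x + y)) = char_val chi (f x) + char_val chi (f y).
Proof. by rewrite linearD char_valD. Qed.

Lemma restrict_character_linear :
  linear (fun chi : charm N => character (restrict_character_morph chi)).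
Proof.
move=> a chi chi'; apply: charm_eq => m.
exact: (congr1 (fun n => char_val chi n + char_val chi' (f m))
  (esym (linearZ_LR f (a : A^c) m))).
Qed.

Definition restrict_character : {linear charm N -> charm M} :=
  linear_of restrict_character_linear.

Lemma restrict_characterE chi m :
  char_val (restrict_character chi) m = char_val chi (f m).
Proof. by []. Qed.

(** The injectivity of Q/Z, applied to the underlying abelian groups. *)
Lemma restrict_character_surjective : injective f ->
  forall psi, exists chi, restrict_character chi = psi.
Proof.
move=> inj_f psi.
have f_linear := additive_int_linear (V := zmodule M) (W := zmodule N)
  (linearD f).
have psi_linear := additive_int_linear (V := zmodule M) (W := QZ)
  (char_valD psi).
have [h hP] := inj_module_extend (i := linear_of f_linear)
  (linear_of psi_linear) QZ_injective inj_f.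
by exists (character (linearD h)); apply: charm_eq.
Qed.
End RestrictCharacter.

(** A nonzero element of the kernel of f (x) V is detected by a character of
    M (x) V, that is a linear map V -> Hom(M, Q/Z); a lift of this map to
    Hom(N, Q/Z) extends the character to N (x) V, where the element is zero. *)
Lemma flat_of_character_lifting (V : lmodType A) :
  (forall (M N : lmodType A^c) (f : {linear M -> N}), injective f ->
   forall alpha : {linear V -> charm M}, exists h : {linear V -> charm N},
   forall x, restrict_character f (h x) = alpha x) ->
  flat_module V.
Proof.
move=> lift M N f inj_f S T s t [s_bal s_univ] [t_bal t_univ] fV fV_tens.
suff ker0 z : fV z = 0 -> z = 0.
  by move=> z w zw; apply/eqP; rewrite -subr_eq0; apply/eqP/ker0;
    rewrite raddfB zw subrr.
move=> fz0; apply: contrapT => z_neq0.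
have [chi] := @character_separates (zmodule S : lmodType int) z z_neq0; apply.
have alphaD x m m' : chi (s (m + m') x) = chi (s m x) + chi (s m' x).
  rewrite (balancedDl s_bal) -[LHS]/(chi ((s m x : zmodule S) + s m' x)).
  by rewrite linearD.
have alpha_linear : linear (fun x => character (alphaD x)).
  move=> a x y; apply: charm_eq => m.
  rewrite [LHS](_ : _ = chi (s m (a *: x + y))) //.
  rewrite [RHS](_ : _ = chi (s ((a : A^c) *: m) x) + chi (s m y)) //.
  rewrite (balancedDr s_bal) (balancedZ s_bal).
  exact: (linearD chi).
have [h hP] := lift M N f inj_f (linear_of alpha_linear).
have h_bal : balanced (fun n x => char_val (h x) n).
  split=> [n n' x|n x x'|a n x]; first exact: char_valD.
    by rewrite linearD char_val_add.
  by rewrite linearZ char_val_scale.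
have [[g gP] _] := t_univ QZ _ h_bal.
have chiD x y : chi ((x + y : S) : zmodule S) =
    chi (x : zmodule S) + chi (y : zmodule S).
  exact: (linearD chi).
have chi_bal : balanced (fun m x => chi (s m x)).
  split=> [m m' x|m x x'|a m x]; first exact: alphaD.
    by rewrite (balancedDr s_bal) chiD.
  by rewrite (balancedZ s_bal).
have [_ uniq_chi] := s_univ QZ _ chi_bal.
have -> : chi z = g (fV z).
  apply: (uniq_chi (additive_of chiD) (g \o fV)) => // m x.
  by rewrite /= fV_tens gP -restrict_characterE hP.
by rewrite fz0 raddf0.
Qed.
End Flatness.

Theorem proposition6p7 (k : comPzRingType) (A : algebra k) (Q : linCat k)
    (r : forall q : Q, mor Q q q -> Prop) :
  noetherian k -> hereditary k ->
  hom_finite Q -> locally_bounded Q ->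
  (exists S : linFunctor Q Q, serre_functor S) ->
  strong_retraction r -> nilpotent_pseudo_radical r ->
  forall X : qmod Q A,
    left_perp (fun N : qmod Q A => Cot N /\ exact_object N) X ->
    forall q : Q, flat_module (X q).
Proof.
move=> _ hered homfin _ _ _ _ X perpX q.
have projQ p : projective_module (mor Q p q) := (homfin p q).2.
apply: flat_of_character_lifting => M N f inj_f alpha.
pose g := restrict_character f.
have subR := in_range_submodule f.
pose K := annihilator subR.
pose j : {linear K -> charm N} := submod_val (subP := vanishes_submodule subR).
have ext0 : Ext1_vanishes X (coind q K).
  apply: perpX; split; first exact: coind_annihilator_Cot.
  right; have [I0 [i [injI0 inj_i]]] :=
    enough_injectives (restr_scalars K : lmodType k).
  exact: finite_id_coind projQ _ i injI0 inj_i.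
have [p phi psi eq_phi|p phi|p psi|h hP] := @Ext1_vanishes_lift _ _ _ X _ _ _
  (coind_map q j) (coind_map q g) (transpose alpha) _ _ _ ext0 q.
- apply: coind_eq => s; apply: submod_val_inj.
  by have := congr1 (fun z => coind_val z s) eq_phi; rewrite !coind_val_map.
- split=> [g0|[psi <-]]; last first.
    apply: coind_eq => s; rewrite !coind_val_map; apply: charm_eq => m.
    by apply: (submodP (coind_val psi s)); exists m.
  have phi_vanishes s : vanishes (in_range f) (coind_val phi s).
    by move=> _ [m <-]; rewrite -restrict_characterE -(coind_val_map g) g0.
  have phi_klinear c s s' :
      in_submod (vanishes_submodule subR) (phi_vanishes (c *: s + s')) =
      alg_str A c *: in_submod (vanishes_submodule subR) (phi_vanishes s) +
      in_submod (vanishes_submodule subR) (phi_vanishes s').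
    by apply: submod_val_inj; exact: coind_val_linear.
  exists (coind_elt phi_klinear : coind q K p).
  by apply: coind_eq => s; rewrite coind_val_map.
- exact/coind_map_surjective/restrict_character_surjective.
exists (counit q _ \o h) => x.
transitivity (coind_val (coind_map q g q (h x)) (idm Q q)).
  by rewrite coind_val_map.
by rewrite hP coind_val_transpose qact1.
Qed.
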